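(* The following hold. (1) $\mathrm{add}(\mathcal{E},\mathcal{N})=\mathrm{cov}(\mathcal{M})$. In particular $\mathrm{add}(\mathcal{E})=\mathrm{add}(\mathcal{M})$. (2) $\mathrm{cof}(\mathcal{E},\mathcal{N})=\mathrm{unif}(\mathcal{M})$. In particular $\mathrm{cof}(\mathcal{E})=\mathrm{cof}(\mathcal{M})$.
   Context: $\mathcal{M}$ and $\mathcal{N}$ denote the ideals of meager and of null subsets of $2^\omega$ (with respect to the standard product measure $\mu$), and $\mathcal{E}$ is the $\sigma$-ideal generated by the closed measure zero subsets of $2^\omega$ (so $\mathcal{E}\subseteq\mathcal{M}\cap\mathcal{N}$). For an ideal $\mathcal{J}$ of subsets of $2^\omega$: $\mathrm{add}(\mathcal{J})=\min\{|\mathcal{A}|:\mathcal{A}\subseteq\mathcal{J},\ \bigcup\mathcal{A}\notin\mathcal{J}\}$; $\mathrm{cov}(\mathcal{J})=\min\{|\mathcal{A}|:\mathcal{A}\subseteq\mathcal{J},\ \bigcup\mathcal{A}=2^\omega\}$; $\mathrm{unif}(\mathcal{J})=\min\{|X|:X\subseteq 2^\omega,\ X\notin\mathcal{J}\}$; $\mathrm{cof}(\mathcal{J})=\min\{|\mathcal{A}|:\mathcal{A}\subseteq\mathcal{J},\ \forall B\in\mathcal{J}\ \exists A\in\mathcal{A}\ B\subseteq A\}$. For a pair of ideals $\mathcal{I}\subseteq\mathcal{J}$: $\mathrm{add}(\mathcal{I},\mathcal{J})=\min\{|\mathcal{A}|:\mathcal{A}\subseteq\mathcal{I},\ \bigcup\mathcal{A}\notin\mathcal{J}\}$;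 $\mathrm{cof}(\mathcal{I},\mathcal{J})=\min\{|\mathcal{A}|:\mathcal{A}\subseteq\mathcal{J},\ \forall B\in\mathcal{I}\ \exists A\in\mathcal{A}\ B\subseteq A\}$. *)

(* Defs.v *)
From HB Require Import structures.
From mathcomp Require Import all_boot all_order all_algebra.
From mathcomp Require Import all_classical all_reals all_analysis.

Set Implicit Arguments.
Unset Strict Implicit.
Unset Printing Implicit Defensive.

Import Order.TTheory GRing.Theory Num.Theory.
Import numFieldNormedType.Exports.

Local Open Scope classical_set_scope.
Local Open Scope ring_scope.
Local Open Scope card_scope.

(* The product measure on 2^omega: the Caratheodory extension, to the product
   sigma-algebra, of the uniform measure on the algebra of sets that depend on
   finitely many coordinates. *)

Definition depends_on (n : nat) (A : set (nat -> bool)) :=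
  forall x y : nat -> bool, (forall i, (i < n)%N -> x i = y i) -> A x -> A y.

Definition cylinder (A : set (nat -> bool)) := exists n, depends_on n A.

Lemma depends_onW m n A : (m <= n)%N -> depends_on m A -> depends_on n A.
Proof.
by move=> mn dA x y xy; apply: dA => i im; apply: xy; exact: leq_trans mn.
Qed.

Lemma cylinder0 : cylinder set0. Proof. by exists 0%N. Qed.

Lemma cylinderU : setU_closed cylinder.
Proof.
move=> A B [n nA] [m mB]; exists (maxn n m) => x y xy [Ax|Bx]; [left|right].
- by apply: (depends_onW (leq_maxl n m) nA) xy Ax.
- by apply: (depends_onW (leq_maxr n m) mB) xy Bx.
Qed.

Lemma cylinderC : setC_closed cylinder.
Proof.
move=> A [n nA]; exists n => x y xy NAx Ay; apply: NAx.
by apply: nA Ay => i /xy.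
Qed.

Definition cylinder_algebra : Type := cantor_space.

HB.instance Definition _ := Pointed.on cylinder_algebra.
HB.instance Definition _ := @isAlgebraOfSets.Build default_measure_display
  cylinder_algebra cylinder cylinder0 cylinderU cylinderC.

Section cylinder_measure.
Variable R : realType.

Definition prefix_count (n : nat) (A : set (nat -> bool)) : nat :=
  #|[pred s : n.-tuple bool | `[< A (nth false s) >]]|.

(* The sequence is eventually constant when A is a cylinder. *)
Definition cylinder_measure (A : set cylinder_algebra) : \bar R :=
  (limn (fun n => (prefix_count n A)%:R / 2 ^+ n : R))%:E.

Lemma prefix_countS n A : depends_on n A ->
  prefix_count n.+1 A = (2 * prefix_count n A)%N.
Proof.
move=> nA; rewrite /prefix_count.
pose h (p : n.-tuple bool * bool) : n.+1.-tuple bool := [tuple of rcons p.1 p.2].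
have hinj : injective h.
  move=> [s b] [t c] /(congr1 val) /= /rcons_inj[] st bc.
  by congr (_, _) => //; exact: val_inj.
have hbij : bijective h.
  by apply: inj_card_bij => //; rewrite card_prod !card_tuple card_bool expnSr.
rewrite -!sum1_card (reindex h) /=; last exact: onW_bij.
rewrite (eq_bigl (fun p : n.-tuple bool * bool =>
  `[< A (nth false p.1) >] && true)); last first.
  move=> [s b]; rewrite !inE /= andbT; apply/asboolP/asboolP; apply: nA => i ni.
    by rewrite nth_rcons size_tuple ni.
  by rewrite nth_rcons size_tuple ni.
rewrite -(pair_big (fun s : n.-tuple bool => `[< A (nth false s) >])
  (fun _ : bool => true) (fun _ _ => 1%N)) /=.
by rewrite sum_nat_const sum1_card card_bool mulnC sum1_card.
Qed.

Lemma cylinder_measureE n (A : set cylinder_algebra) : depends_on n A ->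
  cylinder_measure A = ((prefix_count n A)%:R / 2 ^+ n)%:E.
Proof.
move=> nA; congr (_%:E); apply: lim_near_cst => //; exists n => // m /= nm.
rewrite -(subnK nm); elim: (m - n)%N => [|k IH]; first by rewrite add0n.
rewrite addSn prefix_countS; last exact: depends_onW (leq_addl _ _) nA.
by rewrite -IH natrM exprS invfM mulrACA divff ?mul1r.
Qed.

Lemma cylinder_measure0 : cylinder_measure set0 = 0%E.
Proof.
rewrite (@cylinder_measureE 0) // /prefix_count eq_card0 ?mul0r// => s.
by rewrite !inE; apply/asboolP.
Qed.

Lemma cylinder_measure_ge0 A : (0 <= cylinder_measure A)%E.
Proof.
rewrite lee_fin /cylinder_measure; set u := (u in limn u).
have [cu|/dvgP ->//] := pselect (cvgn u).
by apply: limr_ge => //; apply: nearW => n; exact: divr_ge0.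
Qed.

Lemma cylinder_measureU A B : cylinder A -> cylinder B -> A `&` B = set0 ->
  cylinder_measure (A `|` B) = (cylinder_measure A + cylinder_measure B)%E.
Proof.
move=> [n nA] [m mB] AB0.
have kA := depends_onW (leq_maxl n m) nA.
have kB := depends_onW (leq_maxr n m) mB.
have kAB : depends_on (maxn n m) (A `|` B).
  by move=> x y xy [/(kA _ _ xy)|/(kB _ _ xy)]; [left|right].
rewrite (cylinder_measureE kA) (cylinder_measureE kB) (cylinder_measureE kAB).
rewrite -EFinD -mulrDl -natrD; congr ((_%:R / _)%:E).
rewrite /prefix_count -cardUI addnC [X in (X + _)%N]eq_card0 ?add0n.
  apply: eq_card => s; rewrite !inE; apply/asboolP/orP => -[] ABs.
  - by left; apply/asboolP.
  - by right; apply/asboolP.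
  - by left; apply/asboolP.
  - by right; apply/asboolP.
move=> s; rewrite !inE; apply/negP => /andP[/asboolP As /asboolP Bs].
by have : set0 (nth false s) by rewrite -AB0.
Qed.

Lemma cylinder_open A : cylinder A -> @open cantor_space A.
Proof.
move=> [n nA]; rewrite openE => x Ax.
have xn : nbhs (x : cantor_space)
    [set y : cantor_space | forall i, (i < n)%N -> x i = y i].
  elim: {nA} n => [|n IH]; first exact: filterS filterT.
  have pn : nbhs (x : cantor_space) [set y : cantor_space | y n = x n].
    exact: (@proj_continuous nat (fun=> bool) n x [set x n] (discrete_set1 _)).
  apply: filterS (filterI IH pn) => y [yx ynx] i.
  by rewrite ltnS leq_eqVlt => /orP[/eqP ->|/yx].
by apply: filterS xn => y xy; exact: nA xy Ax.
Qed.

Lemma cylinder_measure_sigma_additive : semi_sigma_additive cylinder_measure.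
Proof.
move=> F mF tF mUF.
have fin : exists N, forall i, (N <= i)%N -> F i = set0.
  have : compact (\bigcup_i F i : set cantor_space).
    apply: (subclosed_compact _ cantor_space_compact) => //.
    by rewrite -openC; apply: cylinder_open; exact: cylinderC.
  rewrite compact_cover => /(_ nat setT F) [i _||D _ UD].
  - exact: (cylinder_open (mF i)).
  - by [].
  - exists (\max_(i <- finmap.enum_fset D) i.+1)%N => i Di; rewrite -subset0 => x Fix.
    have [j /= jD Fjx] := UD x (ex_intro2 _ _ i I Fix).
    have ij : i = j by apply: tF => //; exists x.
    by move: Di; rewrite leqNgt ij (@leq_bigmax_seq _ _ xpredT (fun i => i.+1)).
have sumE n : cylinder (\bigcup_(i < n) F i) /\
    (\sum_(0 <= i < n) cylinder_measure (F i))%E =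
    cylinder_measure (\bigcup_(i < n) F i).
  elim: n => [|n [cn IH]].
    by rewrite bigcup_mkord big_ord0 big_geq // cylinder_measure0; split=> //;
      exact: cylinder0.
  have SE : \bigcup_(i < n.+1) F i = \bigcup_(i < n) F i `|` F n.
    by rewrite !bigcup_mkord big_ord_recr.
  rewrite SE big_nat_recr //= IH (cylinder_measureU cn (mF n)); last first.
    rewrite -subset0 => x [[i /= lin Fix] Fnx].
    have ein : i = n by apply: tF => //; exists x.
    by rewrite ein ltnn in lin.
  by split=> //; apply: cylinderU => //; exact: mF.
have [N FN] := fin.
apply: cvg_near_cst; exists N => // n /= Nn.
rewrite (sumE n).2; congr cylinder_measure; apply/seteqP; split => x [i].
  by move=> _ Fix; exists i.
move=> _ Fix; exists i => //=; rewrite ltnNge; apply/negP => ni.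
by move: Fix; rewrite FN // (leq_trans Nn).
Qed.

HB.instance Definition _ := isMeasure.Build _ _ _ cylinder_measure
  cylinder_measure0 cylinder_measure_ge0 cylinder_measure_sigma_additive.

Definition cantor_measure := measure_extension cylinder_measure.

HB.instance Definition _ := Measure.on cantor_measure.

Lemma cantor_measure_cylinder n (s : n.-tuple bool) :
  cantor_measure [set x : nat -> bool | forall i : 'I_n, x i = tnth s i] =
  (2 ^- n)%:E.
Proof.
set A := (A in cantor_measure A).
have nA : depends_on n A.
  by move=> x y xy Ax i; rewrite -Ax xy.
rewrite /cantor_measure /measure_extension measurable_mu_extE; last by exists n.
rewrite /= (cylinder_measureE nA) /prefix_count.
rewrite (_ : #|_| = 1%N) ?mul1r// -[RHS](card1 s); apply: eq_card => t.
rewrite !inE; apply/asboolP/eqP => [At|->].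
  by apply: eq_from_tnth => i; rewrite -At (tnth_nth false).
by move=> i; rewrite (tnth_nth false).
Qed.

End cylinder_measure.

Definition nowhere_dense (T : topologicalType) (A : set T) :=
  interior (closure A) = set0.

Definition sigma_ideal (T : Type) (J : set (set T)) :=
  [/\ J set0,
      forall A B, A `<=` B -> J B -> J A &
      forall F : (set T)^nat, (forall n, J (F n)) -> J (\bigcup_n F n)].

Definition meager : set (set cantor_space) :=
  [set A | exists F : (set cantor_space)^nat,
     (forall n, nowhere_dense (F n)) /\ A `<=` \bigcup_n F n].

Definition null (R : realType) : set (set cantor_space) :=
  [set A | (cantor_measure R).-negligible A].

Definition closed_null_ideal (R : realType) : set (set cantor_space) :=
  smallest (@sigma_ideal cantor_space) [set A | closed A /\ null R A].

(* A cardinal invariant min {|A| : P A} is represented by the collection of all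
   the sets that attain this minimum; two such cardinals are equal when both
   minima are attained, by equipotent sets. *)
Definition min_card (T : Type) (P : set (set T)) : set (set T) :=
  [set A | P A /\ forall B, P B -> A #<= B].

Definition same_card (T U : Type) (k : set (set T)) (l : set (set U)) :=
  exists A B, [/\ k A, l B & A #= B].

Section cardinal_invariants.
Variable T : Type.
Implicit Types I J : set (set T).

Definition add_ideals I J :=
  min_card [set A : set (set T) | A `<=` I /\ ~ J (\bigcup_(X in A) X)].

Definition cof_ideals I J := min_card [set A : set (set T) |
  A `<=` J /\ forall B, I B -> exists2 X, A X & B `<=` X].

Definition add_ideal J := add_ideals J J.

Definition cov_ideal J :=
  min_card [set A : set (set T) | A `<=` J /\ \bigcup_(X in A) X = setT].

Definition unif_ideal J := min_card [set X : set T | ~ J X].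

Definition cof_ideal J := cof_ideals J J.

End cardinal_invariants.

(* Main.v *)
(* For f : nat -> nat and x in 2^omega let B(f, x) be the meager set of those c
   that differ from x on [a, f a) for almost all a; every meager set is contained
   in some B(f, x), and B(f, x) <= B(g, y) holds only if almost every [n, g n)
   contains some [a, f a) on which x and y agree.

   From E to M: a union X of closed null sets is coded by a point x whose blocks
   name cylinders covering initial parts of X, the measure of the cylinder being
   at most 2^-a when its name starts at a. A point outside B(f, x) repeats
   infinitely many of these names, so it decodes to a null set that contains X;
   and B(f, x) <= B(g, y) makes y decode to a member of E that contains X.

   From M to E: a null set that contains a suitable member of E, consisting of the
   sequences vanishing at almost all points of a set of integers, predicts that
   set well enough to yield a function infinitely often equal to a given one.
   Using this twice, first for a partition of omega that is not too fine for f,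
   then for guessing x on its pieces, gives a point outside B(f, x). A third
   member of E bounds the gaps between the places where this point agrees with x
   and so yields a meager set that contains B(f, x). The stages depend on each
   other, so on the side of unif and cof one uses kappa * kappa = kappa. *)

Require Import Defs.
From mathcomp Require Import reals.
From mathcomp Require Import all_boot all_order all_algebra.
From mathcomp Require Import all_classical all_reals all_analysis.
From mathcomp Require Import lra zify.

Set Implicit Arguments.
Unset Strict Implicit.
Unset Printing Implicit Defensive.

Import Order.TTheory GRing.Theory Num.Theory.
Import numFieldNormedType.Exports.

Local Open Scope classical_set_scope.
Local Open Scope ring_scope.
Local Open Scope card_scope.

(** * Cardinals *)

Section cardinals.
Local Open Scope nat_scope.

Lemma card_le_inj T U (A : set T) (B : set U) (f : T -> U) :
  (forall a, A a -> B (f a)) ->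
  (forall a b, A a -> A b -> f a = f b -> a = b) -> A #<= B.
Proof.
move=> AB finj; have : $|{injfun A >-> B}|.
  apply/injfunPex; exists f => // a b /set_mem Aa /set_mem Ab; exact: finj.
by case=> g; exact: inj_card_le.
Qed.

Lemma card_le_injP T U (A : set T) (B : set U) : A !=set0 -> A #<= B ->
  exists f : T -> U, (forall a, A a -> B (f a)) /\
    (forall a b, A a -> A b -> f a = f b -> a = b).
Proof.
move=> [a0 Aa0] /card_leP[g].
pose f a : U := match pselect (A a) with
  | left Aa => set_val (g (SigSub (mem_set Aa)))
  | right _ => set_val (g (SigSub (mem_set Aa0))) end.
exists f; split=> [a Aa|a b Aa Ab]; rewrite /f.
  by case: pselect => // Aa'; exact/set_mem/valP.
case: pselect => // Aa'; case: pselect => // Ab' /val_inj gab.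
by have /(congr1 val) := (inj (mem_set I) (mem_set I) gab).
Qed.

(* A maximal set of choice functions for the members of P, any two of which
   differ everywhere, has some coordinate projection onto a member of P: this
   member embeds in all the others through the other projections. *)
Lemma min_card_exists T (P : set (set T)) : P !=set0 -> min_card P !=set0.
Proof.
move=> [A0 PA0]; pose I := {A : set T | P A}.
pose Q (X : set (I -> T)) := (forall x i, X x -> sval i (x i)) /\
  (forall x y i, X x -> X y -> x i = y i -> x = y).
have [|X [[Xin Xinj] Xmax]] := @Zorn_bigcup _ Q.
  move=> F FQ Ftot; split=> [x i [X FX Xx]|x y i [X FX Xx] [Y FY Yy]].
    exact: (FQ _ FX).1.
  have [XY|YX] := Ftot _ _ FX FY; first exact: (FQ _ FY).2 (XY _ Xx) Yy.
  exact: (FQ _ FX).2 Xx (YX _ Yy).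
(* If every projection missed a point, these points would form a choice function extending [X]. *)
have [i iX] : exists i : I, forall a, sval i a -> exists2 x, X x & x i = a.
  apply: contrapT => /forallNP noi.
  have /choice[z zP] : forall i : I, exists a, sval i a /\ forall x, X x -> x i <> a.
    move=> i; have /existsNP[a] := noi i.
    move=> /not_implyP[ia Na]; exists a; split=> // x Xx xia; apply: Na.
    by exists x.
  pose i0 : I := exist _ _ PA0.
  have nXz : ~ X z by move=> /((zP i0).2 z).
  apply: (Xmax (z |` X)).
    by split=> [x Xx|/(_ z (or_introl erefl))//]; right.
  split=> [x i [->|Xx]|x y i]; [exact: (zP i).1|exact: Xin|].
  case=> [->|Xx]; case=> [->|Xy] //; last exact: Xinj.
    by move=> /esym /((zP i).2 _ Xy).
  by move=> /((zP i).2 _ Xx).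
exists (sval i); split; first exact: (svalP i).
move=> B PB; pose j : I := exist _ _ PB.
apply: (@card_le_trans _ _ _ X).
  apply: (card_le_trans _ (card_image_le (fun x : I -> T => x i) X)).
  by apply: subset_card_le => a /iX[x Xx xia]; exists x.
apply: (@card_le_inj _ _ _ _ (fun x => x j)) => [x Xx|x y Xx Xy].
  exact: Xin x j Xx.
exact: Xinj.
Qed.

(** The scheme of all four equalities: translations in both directions that do not increase
    cardinality, while [min_card_exists] provides the minima. *)
Lemma same_card_min T U (P : set (set T)) (Q : set (set U)) :
  P !=set0 -> (forall A, P A -> exists2 B, Q B & B #<= A) ->
  (forall B, Q B -> exists2 A, P A & A #<= B) ->
  same_card (min_card P) (min_card Q).
Proof.
move=> P0 PQ QP; have [A [PA Amin]] := min_card_exists P0.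
have [B0 QB0 _] := PQ _ PA.
have [B [QB Bmin]] := @min_card_exists _ Q (ex_intro _ _ QB0).
exists A, B; split=> //; apply/card_eqPle; split.
  by have [A' PA' A'B] := QP _ QB; exact: card_le_trans (Amin _ PA') A'B.
by have [B' QB' B'A] := PQ _ PA; exact: card_le_trans (Bmin _ QB') B'A.
Qed.

Lemma card_le_total T (A B : set T) : A #<= B \/ B #<= A.
Proof.
have [|C [CAB Cmin]] := @min_card_exists _ [set A; B]; first by exists A; left.
by case: CAB Cmin => -> Cmin; [left|right]; apply: Cmin; [right|left].
Qed.

(** * Squares of infinite sets *)

Section square.
Variables (T : Type) (A : set T).

(** A pairing is kept as a graph, its base set read off the diagonal, so that chains can be joined
    by unions. *)
Let dom (G : set ((T * T) * T)) := [set a | exists c, G ((a, a), c)].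

Let pairing (G : set ((T * T) * T)) := [/\
  forall p c c', G (p, c) -> G (p, c') -> c = c',
  forall p p' c, G (p, c) -> G (p', c) -> p = p',
  forall a b, dom G a -> dom G b -> exists c, G ((a, b), c) &
  forall a b c, G ((a, b), c) -> [/\ dom G a, dom G b & dom G c]].

Let graph (B : set T) (f : T -> T -> T) :=
  [set q : (T * T) * T | [/\ B q.1.1, B q.1.2 & q.2 = f q.1.1 q.1.2]].

Let graph_pairing (B : set T) (f : T -> T -> T) :
  (forall a b, B a -> B b -> B (f a b)) ->
  (forall a b a' b', B a -> B b -> B a' -> B b' -> f a b = f a' b' ->
    a = a' /\ b = b') ->
  pairing (graph B f) /\ dom (graph B f) = B.
Proof.
move=> fB finj; have domE : dom (graph B f) = B.
  by apply/seteqP; split=> a; [case=> c []|move=> Ba; exists (f a a)].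
split=> //; split; rewrite ?domE.
- by move=> [a b] c c' [/= _ _ ->] [/= _ _ ->].
- move=> [a b] [a' b'] c [/= Ba Bb ->] [/= Ba' Bb' /finj].
  by case=> // -> ->.
- by move=> a b Ba Bb; exists (f a b).
- by move=> a b c [/= Ba Bb ->]; split=> //; exact: fB.
Qed.

(* Zorn's lemma gives a maximal injection B * B -> B with B a subset of A. If A
   does not embed in B, then A \ B contains a copy of B, into which the three
   other blocks of the square of the union can be mapped. *)
Lemma card_setX_infinite : infinite_set A -> A `*` A #<= A.
Proof.
move=> /infiniteP Ainf.
have [e [eA einj0]] := card_le_injP (ex_intro _ 0 I) Ainf.
have einj : injective e by move=> i j; exact: einj0.
have {}eA i : A (e i) by exact: eA.
have [k kE] : exists k : T -> nat, forall i, k (e i) = i.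
  have /choice[k kP] : forall a, exists i, forall j, a = e j -> j = i.
    move=> a; have [[i ->]|/forallNP N] := pselect (exists i, a = e i).
      by exists i => j /einj ->.
    by exists 0 => j /N.
  by exists k => i; rewrite -(kP _ i erefl).
pose f0 a b := e (pickle (k a, k b)).
have [G0P G0dom] : pairing (graph (range e) f0) /\
    dom (graph (range e) f0) = range e.
  apply: graph_pairing => [_ _ [i _ <-] [j _ <-]|].
    by exists (pickle (i, j)) => //; rewrite /f0 !kE.
  move=> _ _ _ _ [i _ <-] [j _ <-] [i' _ <-] [j' _ <-].
  rewrite /f0 !kE => /einj /(pcan_inj pickleK)[-> ->] //.
set G0 := graph (range e) f0 in G0P G0dom.
(* Joining the countable pairing [G0] to each candidate puts the union of the empty chain into [P]
   and two distinct tags into the base set of the maximal one. *)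
pose P G := pairing (G0 `|` G) /\ dom (G0 `|` G) `<=` A.
have [|M [[MP MA] Mmax]] := @Zorn_bigcup _ P.
  move=> F FP Ftot.
  have [->|/set0P[X0 FX0]] := eqVneq F set0.
    rewrite /P bigcup_set0 setU0; split=> //; rewrite G0dom.
    by move=> _ [i _ <-]; exact: eA.
  have UE : G0 `|` \bigcup_(X in F) X = \bigcup_(X in F) (G0 `|` X).
    apply/seteqP; split=> q.
      by case=> [G0q|[X FX Xq]]; [exists X0 => //; left|exists X => //; right].
    by move=> [X FX [G0q|Xq]]; [left|right; exists X].
  have dS X Y : X `<=` Y -> dom X `<=` dom Y.
    by move=> XY a [c Xc]; exists c; exact: XY.
  have two X Y : F X -> F Y -> exists Z, [/\ F Z, G0 `|` X `<=` G0 `|` Z &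
      G0 `|` Y `<=` G0 `|` Z].
    move=> FX FY; have [XY|YX] := Ftot _ _ FX FY.
      by exists Y; split=> //; exact: setUS.
    by exists X; split=> //; exact: setUS.
  have sup Z : F Z -> G0 `|` Z `<=` \bigcup_(X in F) (G0 `|` X).
    by move=> FZ; exact: (@bigcup_sup _ _ Z F (fun X => G0 `|` X)).
  rewrite /P UE; split; last first.
    by move=> a [c [X FX Xc]]; apply: (FP _ FX).2; exists c.
  split.
  - move=> p c c' [X FX Xc] [Y FY Yc]; have [Z [FZ XZ YZ]] := two _ _ FX FY.
    by have [Zf _ _ _] := (FP _ FZ).1; exact: Zf (XZ _ Xc) (YZ _ Yc).
  - move=> p c c' [X FX Xc] [Y FY Yc]; have [Z [FZ XZ YZ]] := two _ _ FX FY.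
    by have [_ Zf _ _] := (FP _ FZ).1; exact: Zf (XZ _ Xc) (YZ _ Yc).
  - move=> a b [c [X FX Xc]] [d [Y FY Yd]].
    have [Z [FZ XZ YZ]] := two _ _ FX FY.
    have [_ _ Zf _] := (FP _ FZ).1.
    have [||u Zu] := Zf a b; first by exists c; exact: XZ.
      by exists d; exact: YZ.
    by exists u; exact: (sup Z FZ).
  - move=> a b c [X FX Xabc]; have [_ _ _ Xf] := (FP _ FX).1.
    have [da db dc] := Xf _ _ _ Xabc.
    by split; apply: (dS _ _ (sup X FX)).
pose G := G0 `|` M; pose B := dom G.
have Gmax G' : G `<` G' -> pairing G' -> dom G' `<=` A -> False.
  move=> [GG' G'G] pG' dG'; apply: (Mmax G'); last first.
    rewrite /P (_ : G0 `|` G' = G') //; apply/setUidPr => q G0q.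
    by apply: GG'; left.
  split=> [q Mq|G'M]; first by apply: GG'; right.
  by apply: G'G => q /G'M Mq; right.
have [Gfun Ginj Gtot Gdom] := MP; rewrite -/G in Gfun Ginj Gtot Gdom.
have BA : B `<=` A := MA.
have eB i : B (e i).
  by exists (f0 (e i) (e i)); left; split=> //=; exists i.
have /choice[f' f'P] : forall p : T * T, exists c, B p.1 -> B p.2 -> G (p, c).
  move=> [a b] /=; have [[Ba Bb]|N] := pselect (B a /\ B b).
    by have [c Gc] := Gtot _ _ Ba Bb; exists c.
  by exists a => Ba Bb; exfalso; apply: N.
pose f a b := f' (a, b).
have fP a b : B a -> B b -> G ((a, b), f a b) by exact: f'P (a, b).
have fB a b : B a -> B b -> B (f a b).
  by move=> Ba Bb; have [] := Gdom _ _ _ (fP _ _ Ba Bb).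
have finj a b a' b' : B a -> B b -> B a' -> B b' -> f a b = f a' b' ->
    a = a' /\ b = b'.
  move=> Ba Bb Ba' Bb' ff.
  have := Ginj _ _ _ (fP _ _ Ba Bb).
  by rewrite ff => /(_ _ (fP _ _ Ba' Bb')) [-> ->].
have GE : G `<=` graph B f.
  move=> [[a b] c] Gabc; have [Ba Bb _] := Gdom _ _ _ Gabc; split=> //=.
  exact: Gfun Gabc (fP _ _ Ba Bb).
have b01 : e 0 <> e 1 by move=> /einj.
suff AB : A #<= B.
  have [a0 Aa0] : A !=set0 by exists (e 0); exact: eA.
  have [h [hB hinj]] := card_le_injP (ex_intro _ _ Aa0) AB.
  apply: (@card_le_inj _ _ _ _ (fun p => f (h p.1) (h p.2))).
    by move=> [a b] [/= /hB ha /hB hb]; apply/BA/fB.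
  move=> [a b] [a' b'] [/= Aa Ab] [/= Aa' Ab'].
  move=> /finj[|||| haa' hbb']; try exact: hB.
  by congr (_, _); apply: hinj.
have [lt|ge] := card_le_total (A `\` B) B.
  have [AB0|AB0] := pselect (A `\` B !=set0).
    have [g [gB ginj]] := card_le_injP AB0 lt.
    (* The tags [e 0] and [e 1] keep the images of [B] and of the rest of [A] apart. *)
    pose h a := if `[< B a >] then f (e 0) a else f (e 1) (g a).
    have gB' a : A a -> ~ B a -> B (g a) by move=> Aa Ba; exact: gB.
    apply: (@card_le_inj _ _ _ _ h) => [a Aa|a b Aa Ab].
      by rewrite /h; case: asboolP => Ba; apply: fB => //; exact: gB'.
    rewrite /h; case: asboolP => Ba; case: asboolP => Bb.
    - by move=> /finj[].
    - by move=> /finj[//|//|//||//]; exact: gB'.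
    - by move=> /finj[//||//|//|] ; [exact: gB'|move=> /esym].
    - by move=> /finj[//||//||_]; [exact: gB'|exact: gB'|exact: ginj].
  apply: subset_card_le => a Aa; apply: contrapT => Ba; apply: AB0.
  by exists a.
have [g [gB ginj]] := card_le_injP (ex_intro _ _ (eB 0)) ge.
exfalso.
pose C := g @` B.
have CB a : C a -> ~ B a by move=> [b /gB[_ Bgb] <-].
have /choice[r rP] : forall a, exists b, (B a -> b = a) /\
    (C a -> B b /\ g b = a).
  move=> a; have [Ba|Ba] := pselect (B a).
    by exists a; split=> // /CB.
  have [[b Bb gb]|Ca] := pselect (C a); first by exists b.
  by exists a; split.
(* A point of [D] is coded in [B] by a tag [t], telling [B] from [C], and a representative [r]. *)
pose t a := if `[< B a >] then e 0 else e 1.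
pose D := B `|` C.
have rB a : D a -> B (r a).
  by case=> [Ba|Ca]; [rewrite (rP a).1|have [] := (rP a).2 Ca].
have tB a : B (t a) by rewrite /t; case: ifP => _; exact: eB.
have trinj a b : D a -> D b -> t a = t b -> r a = r b -> a = b.
  rewrite /t => Da Db; case: asboolP => Ba; case: asboolP => Bb //.
  - by move=> _; rewrite (rP a).1// (rP b).1.
  - by move=> /esym.
  - case: Da => // /(rP a).2[_ {2}<-]; case: Db => // /(rP b).2[_ {2}<-].
    by move=> _ ->.
pose f2 a b := if `[< B a /\ B b >] then f a b else
  g (f (f (t a) (t b)) (f (r a) (r b))).
have f2T a b : B a /\ B b -> f2 a b = f a b.
  by move=> Bab; rewrite /f2; case: asboolP.
have f2F a b : ~ (B a /\ B b) ->
    f2 a b = g (f (f (t a) (t b)) (f (r a) (r b))).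
  by move=> Bab; rewrite /f2; case: asboolP.
have fr c d : D c -> D d -> B (f (r c) (r d)).
  by move=> Dc Dd; apply: (fB); exact: rB.
have ft c d : B (f (t c) (t d)) by exact: fB.
have f2C a b : D a -> D b -> ~ (B a /\ B b) -> C (f2 a b).
  move=> Da Db N; rewrite f2F//.
  exists (f (f (t a) (t b)) (f (r a) (r b))) => //.
  by apply: fB => //; exact: fr.
have [] := @graph_pairing D f2.
- move=> a b Da Db; have [Bab|N] := pselect (B a /\ B b).
    by left; rewrite f2T//; case: Bab => *; exact: fB.
  by right; exact: f2C.
- move=> a b a' b' Da Db Da' Db'.
  have [Bab|N] := pselect (B a /\ B b); have [Bab'|N'] := pselect (B a' /\ B b').
  + by rewrite !f2T//; case: Bab Bab' => ? ? [? ?]; exact: finj.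
  + move=> E; have := f2C _ _ Da' Db' N'; rewrite -E => /CB; case.
    by rewrite f2T//; case: Bab => *; exact: fB.
  + move=> E; have := f2C _ _ Da Db N; rewrite E => /CB; case.
    by rewrite f2T//; case: Bab' => *; exact: fB.
  + rewrite !f2F// => /ginj E.
    have {E} := E (fB _ _ (ft _ _) (fr _ _ Da Db)) (fB _ _ (ft _ _) (fr _ _ Da' Db')).
    case/finj; rewrite ?ft//; try exact: fr.
    move=> /finj[||||taa' tbb'] //; move=> /finj[|||| raa' rbb']; try exact: rB.
    by split; apply: trinj.
move=> pD dD; apply: (Gmax _ _ pD).
  split=> [q Gq|].
    have [Bq1 Bq2 q2E] := GE _ Gq; split; [by left|by left|].
    by rewrite q2E f2T.
  have Cg : C (g (e 0)) by exists (e 0).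
  move=> /(_ ((g (e 0), g (e 0)), f2 (g (e 0)) (g (e 0)))) GG.
  have [|Bg _ _] := Gdom _ _ _ (GG _); first by split=> //; right.
  exact: CB Cg Bg.
by rewrite dD => a [/BA//|[b /gB[Ag _] <-]].
Qed.

End square.

Lemma card_setX3_infinite T (A : set T) : infinite_set A -> A `*` A `*` A #<= A.
Proof.
move=> Ainf; have [a Aa] := infinite_setN0 Ainf.
have AA := card_setX_infinite Ainf.
have [h [hA hinj]] := card_le_injP (ex_intro _ (a, a) (conj Aa Aa)) AA.
apply: card_le_trans AA.
apply: (@card_le_inj _ _ _ _ (fun p => (h p.1, p.2))).
  by move=> [p b] [/= Ap Ab]; split=> //; exact: hA.
by move=> [p b] [q c] [/= Ap Ab] [/= Aq Ac] [/hinj -> // ->].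
Qed.

Lemma card_le_image_setX T U (A : set T) (f : T -> T -> U) : infinite_set A ->
  [set f a b | a in A & b in A] #<= A.
Proof.
move=> Ainf; apply: card_le_trans (card_setX_infinite Ainf).
apply: card_le_trans (card_image_le (fun p => f p.1 p.2) _).
by apply: subset_card_le => _ [a Aa [b Ab <-]]; exists (a, b).
Qed.

End cardinals.

(** * Topology of the Cantor space *)

Section cantor_topology.
Local Open Scope nat_scope.
Implicit Types (A K O : set cantor_space) (x y z : cantor_space).

Lemma closed_countable_subcover K (F : (set cantor_space)^nat) :
  closed K -> (forall i, open (F i)) -> K `<=` \bigcup_i F i ->
  exists n, K `<=` \bigcup_(i < n) F i.
Proof.
move=> cK oF KF.
have : compact K by exact: (subclosed_compact cK cantor_space_compact).
rewrite compact_cover => /(_ nat setT F) [i _||D _ KD]; [exact: oF|exact: KF|].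
exists (\max_(i <- finmap.enum_fset D) i.+1) => z /KD[i /= Di Fiz].
by exists i => //=; rewrite (@leq_bigmax_seq _ _ xpredT (fun i => i.+1)).
Qed.

Lemma cylinder_closed A : cylinder A -> closed A.
Proof. by move=> cA; rewrite -openC; apply/cylinder_open/cylinderC. Qed.

Lemma coordinate_depends n b : depends_on n.+1 [set z : nat -> bool | z n = b].
Proof. by move=> x y xy <-; rewrite xy. Qed.

(** The clopen sets of points differing from [z] at one coordinate cover the complement of [O],
    which is compact. *)
Lemma open_prefix O z : open O -> O z ->
  exists n, forall y, (forall i, i < n -> z i = y i) -> O y.
Proof.
move=> oO Oz; pose F i : set cantor_space := [set y | y i = ~~ z i].
have [|i|y Oy|n KF] := @closed_countable_subcover (~` O) F.
- by rewrite closedC.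
- by apply: cylinder_open; exists i.+1; exact: coordinate_depends.
- apply: contrapT => nF; apply: Oy; rewrite (_ : y = z) //.
  apply/funext => i; apply/eqP/negPn/negP => yz; apply: nF; exists i => //=.
  by move: yz; rewrite /F /=; case: (y i); case: (z i).
exists n => y zy; apply: contrapT => /KF[i /= ltin].
by rewrite /F /= zy//; case: (y i).
Qed.

Lemma nowhere_dense_avoid A : nowhere_dense A -> forall x (n : nat),
  exists z : cantor_space, exists m,
    (forall i, i < n -> x i = z i) /\
    forall y : cantor_space, (forall i, i < m -> z i = y i) -> ~ A y.
Proof.
move=> A0 x n; pose U : set cantor_space := [set z | forall i, i < n -> x i = z i].
have oU : open U.
  by apply: cylinder_open; exists n => y z yz Uy i ni; rewrite Uy// yz.
have [z [Uz Az]] : exists z, U z /\ ~ closure A z.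
  apply: contrapT => /forallNP N.
  have : interior (closure A) x.
    apply: (filterS _ (open_nbhs_nbhs (conj oU (fun i _ => erefl (x i))))) => z Uz.
    by apply: contrapT => Az; exact: (N z).
  by rewrite A0.
have [|//|m mz] := @open_prefix (~` closure A) z.
  by rewrite openC; exact: closed_closure.
exists z, m; split=> // y /mz; apply: contra_not; exact: subset_closure.
Qed.

Lemma closed_nowhere_dense K : closed K ->
  (forall x n, exists z : cantor_space, (forall i, i < n -> x i = z i) /\ ~ K z) ->
  nowhere_dense K.
Proof.
move=> cK KN; rewrite /nowhere_dense -(proj1 (closure_id K) cK) -subset0 => z zK.
have [|n Kn] := @open_prefix (interior K) z _ zK; first exact: open_interior.
have [y [zy nKy]] := KN z n; exfalso; apply: nKy.
exact: (@interior_subset _ K y (Kn y zy)).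
Qed.

(** By induction on the list: the string is lengthened so as to leave the next set, which preserves
    what was achieved for the other pairs. *)
Lemma nowhere_dense_extension (F : (set cantor_space)^nat) n
    (l : seq ((n.-tuple bool) * nat)) :
  (forall i, nowhere_dense (F i)) ->
  exists t : seq bool, forall u i, (u, i) \in l -> forall y : cantor_space,
    (forall j, j < n -> y j = nth false u j) ->
    (forall j, j < size t -> y (n + j) = nth false t j) -> ~ F i y.
Proof.
move=> F0; elim: l => [|[u i] l [t IH]]; first by exists [::].
have [z [m [zE mz]]] := nowhere_dense_avoid (F0 i) (nth false (u ++ t)) (n + size t).
exists (t ++ mkseq (fun j => z (n + size t + j)) m) => v k.
rewrite inE => /orP[/eqP[-> ->] y yu yt|vl y yv yt]; last first.
  apply: IH vl _ yv _ => j jt; rewrite yt ?nth_cat ?jt// size_cat.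
  exact: ltn_addr.
apply: mz => j jm; have [jn|nj] := ltnP j n.
  by rewrite -zE ?ltn_addr// yu// nth_cat size_tuple jn.
rewrite -(subnKC nj); have [jt|tj] := ltnP (j - n) (size t).
  rewrite -zE ?ltn_add2l// yt ?nth_cat ?jt ?size_cat ?ltn_addr//.
  by rewrite size_tuple ltnNge leq_addr/= addKn.
rewrite yt ?size_cat ?size_mkseq ?nth_cat.
  rewrite ltnNge tj/= nth_mkseq -?addnA ?(subnKC tj)//.
  by rewrite ltn_subLR// ltn_subLR// (leq_trans jm)// addnA leq_addl.
by rewrite ltn_subLR// (leq_trans jm)// addnA leq_addl.
Qed.

End cantor_topology.

(** * Outer measure *)

Section outer_measure.
Variable R : realType.
Implicit Types (A B : set cantor_space).

(** [cantor_measure] unfolds to this outer measure; using it on arbitrary sets spares measurability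
    arguments. *)
Definition outer A : \bar R := mu_ext (@cylinder_measure R) A.

Lemma outer_ge0 A : (0 <= outer A)%E.
Proof. exact: mu_ext_ge0 (@cylinder_measure_ge0 R) A. Qed.

Lemma outer0 : outer set0 = 0%E.
Proof. exact: mu_ext0 (cylinder_measure0 R) (@cylinder_measure_ge0 R). Qed.

Lemma le_outer A B : A `<=` B -> (outer A <= outer B)%E.
Proof. exact: (@le_mu_ext _ cylinder_algebra R). Qed.

Lemma outer_cylinder A : cylinder A -> outer A = cylinder_measure R A.
Proof.
move=> cA; exact: (@measurable_mu_extE _ R cylinder_algebra (@cylinder_measure R) A cA).
Qed.

Lemma outer_sigma_subadditive (F : (set cantor_space)^nat) :
  (outer (\bigcup_n F n) <= \sum_(n <oo) outer (F n))%E.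
Proof. exact: mu_ext_sigma_subadditive (@cylinder_measure_ge0 R) F. Qed.

Lemma outerU A B : (outer (A `|` B) <= outer A + outer B)%E.
Proof. exact: (outer_measureU2 (mu_ext (@cylinder_measure R))). Qed.

Lemma outer_bigcup_seq (s : seq nat) (F : nat -> set cantor_space) (e : R) :
  (0 <= e)%R -> (forall i, i \in s -> outer (F i) <= e%:E)%E ->
  (outer [set z | exists2 i, i \in s & F i z] <= ((size s)%:R * e)%:E)%E.
Proof.
move=> e0; elim: s => [_|i s IH Fs].
  rewrite mul0r (_ : [set _ | _] = set0) ?outer0//.
  by rewrite -subset0 => z [].
apply: (@le_trans _ _ (outer (F i `|` [set z | exists2 i, i \in s & F i z]))).
  apply: le_outer => z [j]; rewrite inE => /orP[/eqP ->|js Fz]; [by left|right].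
  by exists j.
apply: le_trans (outerU _ _) _; rewrite /= -natr1 mulrDl mul1r EFinD.
rewrite [leLHS]addeC; apply: leeD; last by apply: Fs; rewrite inE eqxx.
by apply: IH => j js; apply: Fs; rewrite inE js orbT.
Qed.

Lemma prefix_count_coord n (A : set (nat -> bool)) b : depends_on n A ->
  prefix_count n.+1 (A `&` [set z | z n = b]) = prefix_count n A.
Proof.
move=> nA; rewrite /prefix_count.
pose h (s : n.-tuple bool) : n.+1.-tuple bool := [tuple of rcons s b].
have hinj : injective h.
  by move=> s t /(congr1 val) /= /rcons_inj[] st; exact: val_inj.
rewrite -[RHS](fintype.card_image hinj); apply: eq_card => t.
rewrite !inE; apply/asboolP/fintype.imageP => [[At tb]|[s]].
  have sz : size (take n t) == n by rewrite size_takel// size_tuple.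
  have tE : t = h (Tuple sz).
    apply: val_inj; rewrite /= -tb -take_nth ?size_tuple//.
    by rewrite take_oversize// size_tuple.
  exists (Tuple sz) => //; rewrite unfold_in /=; apply/asboolP.
  by apply: (nA _ _ _ At) => i ni /=; rewrite nth_take.
rewrite unfold_in /= => /asboolP As ->; split => /=.
  by apply: (nA _ _ _ As) => i ni /=; rewrite nth_rcons size_tuple ni.
by rewrite nth_rcons size_tuple ltnn eqxx.
Qed.

Lemma outer_coordinates (P : pred nat) b n :
  outer [set z | forall i, (i < n)%N -> P i -> z i = b] =
  (2 ^- count P (iota 0 n))%:E.
Proof.
pose C k := [set z : nat -> bool | forall i, (i < k)%N -> P i -> z i = b].
have CD k : depends_on k (C k).
  by move=> x y xy Cx i ik Pi; rewrite -(xy _ ik) Cx.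
rewrite outer_cylinder; last by exists n; exact: CD.
rewrite (@cylinder_measureE _ n)//.
(* A coordinate in [P] preserves the number of admissible prefixes; any other coordinate doubles
   it. *)
suff E : (prefix_count n (C n) * 2 ^ count P (iota 0 n) = 2 ^ n)%N.
  have pc0 : (prefix_count n (C n))%:R != 0 :> R.
    rewrite pnatr_eq0 -lt0n; have : (0 < 2 ^ n)%N by rewrite expn_gt0.
    by rewrite -E muln_gt0 => /andP[].
  congr (_%:E); rewrite -!natrX -E natrM invfM mulrA.
  by rewrite -/(C n) divff ?mul1r.
elim: n => [|n IH].
  rewrite /prefix_count /= muln1 (_ : #|_| = #|{: 0.-tuple bool}|).
    by rewrite card_tuple.
  by apply: eq_card => s; rewrite !inE; apply/asboolP.
rewrite -addn1 iotaD count_cat /= add0n addn0 addn1.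
have [Pn|Pn] /= := boolP (P n).
  rewrite (_ : C n.+1 = C n `&` [set z | z n = b]).
    by rewrite prefix_count_coord// addn1 !expnSr mulnA IH.
  apply/seteqP; split => z => [Cz|[Cz zn] i].
    by split=> [i ik|]; apply: Cz => //; exact: ltnW.
  by rewrite ltnS leq_eqVlt => /predU1P[->//|]; exact: Cz.
rewrite (_ : C n.+1 = C n).
  by rewrite prefix_countS// ?addn0 -mulnA IH expnS.
apply/seteqP; split => z Cz i; first by move=> ik; apply: Cz; exact: ltnW.
by rewrite ltnS leq_eqVlt => /predU1P[->|]; [rewrite (negbTE Pn)|exact: Cz].
Qed.

Lemma outer_mem (s : seq nat) b : uniq s ->
  outer [set z | forall i, i \in s -> z i = b] = (2 ^- size s)%:E.
Proof.
move=> us; have sb i : i \in s -> (i < (\max_(j <- s) j).+1)%N.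
  by move=> si; rewrite ltnS (@leq_bigmax_seq _ _ xpredT id).
transitivity (outer [set z | forall i, (i < (\max_(j <- s) j).+1)%N ->
    i \in s -> z i = b]).
  congr outer; apply/seteqP; split => z Cz i; first by move=> _; exact: Cz.
  by move=> si; apply: Cz => //; exact: sb.
rewrite outer_coordinates; congr ((2 ^- _)%:E); rewrite -size_filter.
apply/perm_size/uniq_perm => //; first exact/filter_uniq/iota_uniq.
move=> i; rewrite mem_filter mem_iota add0n /=.
by have [/sb ->//|] := boolP (i \in s).
Qed.

Lemma outer_setT : outer setT = 1%E.
Proof.
have := @outer_mem [::] true isT; rewrite expr0 invr1 => <-.
by congr outer; apply/seteqP; split.
Qed.

Lemma outer_eq0 A : (forall n : nat, outer A <= (2 ^- n)%:E)%E -> outer A = 0%E.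
Proof.
move=> An; apply/eqP; rewrite eq_le outer_ge0 andbT.
apply/lee_addgt0Pr => e e0; rewrite add0e.
have [n ne] : exists n : nat, (e^-1 < n%:R)%R.
  by exists (Num.bound e^-1); rewrite archi_boundP// invr_ge0 ltW.
apply: le_trans (An n) _; rewrite lee_fin -[leRHS]invrK lef_pV2 ?posrE ?invr_gt0//.
  by apply/ltW/(lt_trans ne); rewrite -natrX ltr_nat ltn_expl.
Qed.

Lemma outer_null_cover A (e : R) : outer A = 0%E -> (0 < e)%R ->
  exists F : (set cantor_space)^nat, [/\ forall i, cylinder (F i),
    A `<=` \bigcup_i F i & (\sum_(i <oo) outer (F i) <= e%:E)%E].
Proof.
move=> A0 e0; have A0' : outer A \is a fin_num by rewrite A0.
have [_ [F [cF AF] <-]] := lb_ereal_inf_adherent e0 A0'.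
rewrite [X in (X + _)%E](A0 : ereal_inf _ = _) add0e => /ltW Fe.
exists F; split=> //; apply: le_trans Fe; apply: lee_nneseries => i *.
  exact: outer_ge0.
by rewrite outer_cylinder ?lexx//; exact: cF.
Qed.

(** From outer measure zero, covers of total measure at most [2 ^- n] intersect in a measurable null
    superset. *)
Lemma nullP A : null R A <-> outer A = 0%E.
Proof.
split=> [[B [_ B0 AB]]|A0].
  by apply/eqP; rewrite eq_le outer_ge0 andbT -B0; exact: le_outer.
have /choice[F FP] : forall n, exists F : (set cantor_space)^nat,
    [/\ forall i, cylinder (F i), A `<=` \bigcup_i F i &
     (\sum_(i <oo) outer (F i) <= (2 ^- n)%:E)%E].
  by move=> n; apply: outer_null_cover => //; rewrite invr_gt0 exprn_gt0.
exists (\bigcap_n \bigcup_i F n i); split.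
- apply: bigcapT_measurable => n; apply: bigcupT_measurable => i.
  by apply: sub_sigma_algebra; case: (FP n) => + _ _; exact.
- apply: outer_eq0 => n; case: (FP n) => _ _; apply: le_trans.
  apply: le_trans (outer_sigma_subadditive _); apply: le_outer.
  exact: bigcap_inf.
- by move=> z Az n _; case: (FP n) => _ + _; exact.
Qed.

Lemma null_subset A B : A `<=` B -> null R B -> null R A.
Proof.
move=> AB /nullP B0; apply/nullP/eqP; rewrite eq_le outer_ge0 andbT -B0.
exact: le_outer.
Qed.

Lemma null_bigcup (F : (set cantor_space)^nat) :
  (forall n, null R (F n)) -> null R (\bigcup_n F n).
Proof.
move=> nF; apply/nullP/eqP; rewrite eq_le outer_ge0 andbT.
apply: le_trans (outer_sigma_subadditive _) _; rewrite eseries0// => i _ _.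
exact/nullP.
Qed.

Lemma null_setT : ~ null R setT.
Proof. by move=> /nullP; rewrite outer_setT => /eqP; rewrite eqe oner_eq0. Qed.

Lemma null_coordinates (w : nat -> nat) b : injective w ->
  null R [set z | forall n, z (w n) = b].
Proof.
move=> winj; apply/nullP/outer_eq0 => n.
rewrite -[X in 2 ^- X](size_mkseq w n) -(@outer_mem _ b) ?mkseq_uniq//.
by apply: le_outer => z zw i /mapP[j _ ->].
Qed.

Lemma null_set1 (x : cantor_space) : null R [set x].
Proof.
apply/nullP/outer_eq0 => n.
rewrite /= -(@cantor_measure_cylinder R n [tuple x i | i < n]).
by apply: le_outer => _ -> i; rewrite tnth_mktuple.
Qed.

(** Compactness reduces a countable cover of small total measure to a finite one, whose union is a
    cylinder. *)
Lemma closed_null_cylinder A (e : R) : closed A -> null R A -> (0 < e)%R ->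
  exists C, [/\ cylinder C, A `<=` C & (outer C <= e%:E)%E].
Proof.
move=> cA /nullP A0 e0; have [F [cF AF Fe]] := outer_null_cover A0 e0.
have [n An] := closed_countable_subcover cA (fun i => cylinder_open (cF i)) AF.
exists (\bigcup_(i < n) F i); split=> //.
  elim: n {An} => [|n IH]; first by rewrite bigcup_mkord big_ord0; exact: cylinder0.
  by rewrite bigcup_mkord big_ord_recr -bigcup_mkord; exact: cylinderU.
apply: le_trans Fe; apply: le_trans (outer_sigma_subadditive _).
by apply: le_outer => z [i _ Fiz]; exists i.
Qed.

(** Otherwise the set contains a basic cylinder, whose measure is positive. *)
Lemma closed_null_nowhere_dense A : closed A -> null R A -> nowhere_dense A.
Proof.
move=> cA nA; apply: (closed_nowhere_dense cA) => x n.
apply: contrapT => /forallNP N.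
have /null_subset/(_ nA)/nullP : [set z : nat -> bool | forall i : 'I_n,
    z i = tnth [tuple x i | i < n] i] `<=` A.
  move=> z zx; apply: contrapT => Az; apply: (N z); split=> // i ni.
  by rewrite (zx (Ordinal ni)) tnth_mktuple.
have := cantor_measure_cylinder R [tuple x i | i < n].
rewrite -[LHS]/(outer _) => -> /eqP.
by rewrite eqe invr_eq0 expf_eq0 pnatr_eq0 andbF.
Qed.

End outer_measure.

(** * Meager sets and unions of closed null sets *)

Section avoiding.
Local Open Scope nat_scope.
Implicit Types (x y d c : nat -> bool) (f g : nat -> nat).

Definition agree x y (a b : nat) := forall i, a <= i < b -> x i = y i.

Lemma agree_sub x y a b a' b' : a <= a' -> b' <= b ->
  agree x y a b -> agree x y a' b'.
Proof.
move=> aa' b'b xy i /andP[ai ib]; apply: xy.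
by rewrite (leq_trans aa' ai) (leq_trans ib b'b).
Qed.

Definition avoid f x : set cantor_space :=
  [set c | exists m, forall a, m <= a -> ~ agree c x a (f a)].

Lemma avoidPn f x c : ~ avoid f x c ->
  forall m, exists2 a, m <= a & agree c x a (f a).
Proof.
move=> /forallNP N m; have /existsNP[a] := N m.
by move=> /not_implyP[ma /contrapT ca]; exists a.
Qed.

Lemma avoid_meager f x : meager (avoid f x).
Proof.
exists (fun m => \bigcap_(a in [set a | m <= a]) [set c | ~ agree c x a (f a)]).
split=> [m|c [m cm]]; last by exists m => // a; exact: cm.
apply: closed_nowhere_dense => [|z n].
  apply: closed_bigI => a _; apply: cylinder_closed; exists (f a) => y z yz.
  apply: contra_not => zx i /andP[ai ia]; rewrite yz// zx//.
  by rewrite ai ia.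
(* From [n] on the new point copies [x], so it agrees with [x] on [[a, f a)]. *)
pose a := maxn m n.
exists (fun i => if i < n then z i else x i); split=> [i -> //|].
move=> /(_ a (leq_maxl _ _)); apply => i /andP[ai _].
by rewrite ltnNge (leq_trans (leq_maxr _ _) ai).
Qed.

(** The string of stage [k] may depend on its starting position [b], known once the earlier strings
    are laid down. A padding bit after each string ensures [k <= b] and [b < f k]. *)
Lemma block_sequence (t : nat -> nat -> seq bool) :
  exists x f, forall k, exists b, [/\ k <= b, b < f k,
    b + size (t k b) <= f k &
    forall i, i < size (t k b) -> x (b + i) = nth false (t k b) i].
Proof.
pose s := fix s n := if n is k.+1 then s k ++ rcons (t k (size (s k))) false
  else [::].
have sS k : size (s k.+1) = size (s k) + (size (t k (size (s k)))).+1.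
  by rewrite /= size_cat size_rcons.
have s_ge k : k <= size (s k).
  by elim: k => // k IH; rewrite sS addnS ltnS (leq_trans IH)// leq_addr.
have s_pre k l i : k <= l -> i < size (s k) -> nth false (s l) i = nth false (s k) i.
  move=> kl ik; rewrite -(subnK kl); elim: (l - k) => // n IH.
  rewrite addSn /= nth_cat IH; case: ltnP => // /leq_ltn_trans/(_ ik).
  by rewrite ltnNge; case/negP; elim: n {IH} => // n; rewrite addSn sS;
    move=> /leq_trans; apply; exact: leq_addr.
pose x i := nth false (s i.+1) i.
have xE k i : i < size (s k) -> x i = nth false (s k) i.
  move=> ik; rewrite /x -(s_pre _ (maxn k i.+1)) ?leq_maxr//.
  by rewrite (s_pre k) ?leq_maxl.
exists x, (fun k => size (s k.+1)) => k; exists (size (s k)).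
rewrite sS; split; rewrite ?s_ge// ?leq_add2l// ?addnS ?ltnS ?leq_addr//.
move=> i ik; rewrite (xE k.+1); last first.
  by rewrite sS ltn_add2l (leq_trans ik).
by rewrite /= nth_cat ltnNge leq_addr/= addKn nth_rcons ik.
Qed.

(** The block of stage [a], placed at [b], forces any point containing it there out of [F 0], ...,
    [F a], whatever its first [b] bits. Agreement with [x] on [[a, f a)] copies this block. *)
Lemma meager_sub_avoid (A : set cantor_space) : meager A ->
  exists f x, (forall a, a < f a) /\ A `<=` avoid f x.
Proof.
move=> [F [F0 AF]].
have /choice[t tP] : forall p : nat * nat, exists t : seq bool,
    forall i, i <= p.1 -> forall z y : cantor_space,
    (forall j, j < p.2 -> z j = y j) ->
    (forall j, j < size t -> y (p.2 + j) = nth false t j) -> ~ F i y.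
  move=> [k b] /=; have [t tP] := nowhere_dense_extension
    [seq (u, i) | u <- enum {: b.-tuple bool}, i <- iota 0 k.+1] F0.
  exists t => i ik z y zy; apply: tP [tuple y j | j < b] _ _ _ _.
    apply/allpairsP; exists ([tuple y j | j < b], i).
    by rewrite mem_enum mem_iota add0n ltnS.
  by move=> j jb; rewrite (nth_mktuple _ _ (Ordinal jb)).
have [x [f xf]] := block_sequence (fun k b => t (k, b)).
exists f, x; split=> [a|].
  by have [b [ab bf _ _]] := xf a; exact: leq_ltn_trans bf.
move=> c /AF[n _ Fnc]; exists n => a na ca.
have [b [ab _ bf xb]] := xf a.
apply: (tP (a, b) n na c c _ _ Fnc) => //= j jt.
rewrite -xb// ca// (leq_trans ab (leq_addr _ _))/=.
by rewrite (leq_trans _ bf)// ltn_add2l.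
Qed.

(** The point [c] copies [y] on separated intervals [[s j, g (s j))] starting in [Z], and [d]
    elsewhere. An interval where it always differs from [d] must lie inside a single one of them. *)
Lemma glue g y d (Z : set nat) : (forall m, exists2 n, m <= n & Z n) ->
  exists c, (forall m, exists2 n, m <= n & agree c y n (g n)) /\
    forall a b, a < b -> (forall i, a <= i < b -> c i <> d i) ->
      exists n, [/\ Z n, n <= a, b <= g n & agree c y n (g n)].
Proof.
move=> Zinf; have /choice[h hP] : forall m, exists n, m <= n /\ Z n.
  by move=> m; have [n] := Zinf m; exists n.
have hm m : m <= h m by case: (hP m).
have hZ m : Z (h m) by case: (hP m).
pose s := fix s j := if j is k.+1 then h (maxn (g (s k)) (s k)).+1 else h 0.
have sS k : maxn (g (s k)) (s k) < s k.+1 by exact: hm.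
have sinc k : s k < s k.+1 by apply: leq_ltn_trans (sS k); exact: leq_maxr.
have sg j k : j < k -> g (s j) < s k.
  elim: k => // k IH; rewrite ltnS leq_eqVlt => /predU1P[->|/IH jk].
    by apply: leq_ltn_trans (sS k); exact: leq_maxl.
  exact: ltn_trans (sinc k).
have sZ j : Z (s j) by case: j => [|j]; exact: hZ.
have s_ge k : k <= s k by elim: k => // k IH; exact: leq_ltn_trans (sinc k).
pose c i := if `[< exists j, s j <= i < g (s j) >] then y i else d i.
have cs j : agree c y (s j) (g (s j)).
  by move=> i ij; rewrite /c; case: asboolP => // -[]; exists j.
have cd i : c i <> d i -> exists j, s j <= i < g (s j).
  by rewrite /c; case: asboolP.
exists c; split=> [m|a b ab cab]; first by exists (s m).
have [|j /andP[ja aj]] := cd a; first by apply: cab; rewrite leqnn.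
exists (s j); split=> //; rewrite leqNgt; apply/negP => jb.
have [|k /andP[kj jk]] := cd (g (s j)); first by apply: cab; rewrite jb ltnW.
have [lt|gt|E] := ltngtP j k.
- by have := sg _ _ lt; rewrite ltnNge kj.
- have := sg _ _ gt; rewrite ltnNge => /negP; apply.
  exact: leq_trans (ltnW (leq_ltn_trans ja aj)) (ltnW jk).
- by move: jk; rewrite E ltnn.
Qed.

(** Otherwise gluing [y] into the pointwise negation of [x], on windows [[n, g n)] without such an
    interval, gives a point outside [avoid g y] that agrees with [x] on no [[a, f a)]. *)
Lemma avoid_subset f g x y : (forall a, a < f a) ->
  avoid f x `<=` avoid g y ->
  exists m, forall n, m <= n ->
    exists a, [/\ n <= a, f a <= g n & agree x y a (f a)].
Proof.
move=> fa sub; apply: contrapT => /forallNP N.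
pose Z n := forall a, n <= a -> f a <= g n -> ~ agree x y a (f a).
have [m|c [cy cd]] := @glue g y (fun i => ~~ x i) [set n | Z n].
  have /existsNP[n /not_implyP[mn /forallNP Nn]] := N m.
  by exists n => // a na an xy; apply: (Nn a).
have [|m cm] := sub c.
  exists 0 => a _ cx; have [||n [Zn na an cyn]] := cd a (f a); first exact: fa.
    by move=> i /cx ->; case: (x i).
  by apply: (Zn a) => // i ia; rewrite -cx//; exact: agree_sub cyn i ia.
by have [n /cm] := cy m.
Qed.

Definition tail_zero (w : nat -> nat) : set cantor_space :=
  [set z | exists k, forall n, k <= n -> z (w n) = false].

(** Otherwise copying [y] on windows that miss the range of [w], with zeros elsewhere, gives a point
    of [tail_zero w] outside [avoid g y]. *)
Lemma tail_zero_sub_avoid w g y : tail_zero w `<=` avoid g y ->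
  exists m, forall n, m <= n -> exists j, n <= w j < g n.
Proof.
move=> sub; apply: contrapT => /forallNP N.
have [m|c [cy cd]] := @glue g y xpred0 [set n | forall j, ~~ (n <= w j < g n)].
  have /existsNP[n /not_implyP[mn /forallNP Nn]] := N m.
  by exists n => // j; apply/negP; exact: Nn.
have [|m cm] := sub c; last by have [n /cm] := cy m.
exists 0 => n _; apply/negP => cw.
have [||k [/(_ n) /negP wk kw wg _]] := cd (w n) (w n).+1; first by [].
  by move=> i; rewrite ltnS => /anti_leq <-; rewrite cw.
by apply: wk; rewrite kw.
Qed.

End avoiding.

(** * The ideal E and its coding by points *)

Section closed_null_sets.
Variable R : realType.
Implicit Types (X : set cantor_space).
Notation E := (closed_null_ideal R).

Lemma closed_nullP X : E X <-> exists K : (set cantor_space)^nat,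
  (forall n, closed (K n) /\ null R (K n)) /\ X `<=` \bigcup_n K n.
Proof.
split=> [|[K [cK XK]] J [[J0 JS JU] EJ]]; last first.
  by apply: JS XK _; apply: JU => n; exact: EJ.
pose P := [set X : set cantor_space | exists K : (set cantor_space)^nat,
  (forall n, closed (K n) /\ null R (K n)) /\ X `<=` \bigcup_n K n].
move=> /(_ P); apply; split; last first.
  by move=> A AP; exists (fun=> A); split=> // z Az; exists 0%N.
split=> [|A B AB [K [KP BK]]|F FP].
- exists (fun=> set0); split=> // _; split; first exact: closed0.
  exact/nullP/outer0.
- by exists K; split=> //; exact: subset_trans BK.
have /choice[K KP] := FP.
exists (fun n => let p := odflt (0, 0)%N (unpickle n) in K p.1 p.2).
split=> [n|z [n _ /((KP n).2 z)[m _ Kz]]]; first exact: (KP _).1.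
by exists (pickle (n, m)) => //=; rewrite pickleK.
Qed.

Lemma closed_null_sigma_ideal : sigma_ideal E.
Proof.
split=> [J [[]]//|A B AB EB J JP|F EF J JP]; case: (JP) => -[_ JS JU] _.
- exact: JS AB (EB _ JP).
- by apply: JU => n; exact: EF.
Qed.

Lemma closed_null_sub_null : E `<=` null R.
Proof.
move=> X /closed_nullP[K [KP XK]]; apply: null_subset XK _.
by apply: null_bigcup => n; exact: (KP n).2.
Qed.

Lemma closed_null_sub_meager : E `<=` meager.
Proof.
move=> X /closed_nullP[K [KP XK]]; exists K; split=> // n.
by have [] := KP n; exact: closed_null_nowhere_dense.
Qed.

Lemma closed_null_set1 x : E [set x].
Proof.
apply/closed_nullP; exists (fun=> [set x]); split=> [_|z ->]; last by exists 0%N.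
split; last exact: null_set1.
exact: (accessible_closed_set1 (hausdorff_accessible cantor_space_hausdorff)).
Qed.

Lemma closed_null_tail_zero w : injective w -> E (tail_zero w).
Proof.
move=> winj; apply/closed_nullP.
exists (fun k => [set z | forall n, (k <= n)%N -> z (w n) = false]).
split=> [k|z [k zk]]; last by exists k.
split; last first.
  apply: (@null_subset _ _ [set z | forall n, z (w (k + n)%N) = false]).
    by move=> z zk n; apply: zk; exact: leq_addr.
  by apply: null_coordinates => m n /winj/addnI.
rewrite (_ : mkset _ = \bigcap_(n in [set n | (k <= n)%N])
    [set z | z (w n) = false]) //.
apply: closed_bigI => n _; apply: cylinder_closed; exists (w n).+1.
exact: coordinate_depends.
Qed.

(** An index codes a prefix length and a list of prefixes. Codes of too large a cylinder are read as
    the empty set, so that every index is legitimate at every [a]. *)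
Definition small_cylinder (a i : nat) : set cantor_space :=
  let p : nat * seq (seq bool) := odflt (0%N, [::]) (unpickle i) in
  let C := [set z : cantor_space | mkseq z p.1 \in p.2] in
  if (outer R C <= (2 ^- a)%:E)%E then C else set0.

Lemma small_cylinder_cylinder a i : cylinder (small_cylinder a i).
Proof.
rewrite /small_cylinder; case: (odflt _ _) => n l /=.
case: ifP => _; last exact: cylinder0.
exists n => x y xy /=; rewrite (_ : mkseq x n = mkseq y n)//.
by apply: (@eq_from_nth _ false) => [|j]; rewrite !size_mkseq// => nj;
  rewrite !nth_mkseq// xy.
Qed.

Lemma outer_small_cylinder a i : (outer R (small_cylinder a i) <= (2 ^- a)%:E)%E.
Proof.
rewrite /small_cylinder; case: ifP => // _.
by rewrite outer0 lee_fin invr_ge0 exprn_ge0.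
Qed.

Lemma small_cylinder_surj a (C : set cantor_space) : cylinder C ->
  (outer R C <= (2 ^- a)%:E)%E -> exists i, small_cylinder a i = C.
Proof.
move=> [n nC] Ca.
pose l : seq (seq bool) := map (@tval n bool)
  (seq.filter (fun s : n.-tuple bool => `[< C (nth false s) >]) (enum {: n.-tuple bool})).
exists (pickle (n, l)); rewrite /small_cylinder pickleK /=.
suff -> : [set z : cantor_space | mkseq z n \in l] = C by rewrite Ca.
have nthC (z : cantor_space) : C (nth false (mkseq z n)) <-> C z.
  by split; apply: nC => i ni; rewrite nth_mkseq.
apply/seteqP; split=> z /=.
  by move=> /mapP[s]; rewrite mem_filter => /andP[/asboolP Cs _] zs; apply/nthC;
    rewrite zs.
move=> /nthC Cz; apply/mapP.
have sz : size (mkseq z n) == n by rewrite size_mkseq.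
by exists (Tuple sz) => //; rewrite mem_filter mem_enum andbT; apply/asboolP.
Qed.

(* The block 0^i 1 of y at position a is read as the code i. *)
Definition decode (a : nat) (y : nat -> bool) : set cantor_space :=
  [set z | exists i, [/\ forall j, (j < i)%N -> y (a + j)%N = false,
    y (a + i)%N & small_cylinder a i z]].

Lemma decodeP a y : decode a y = set0 \/ exists i, decode a y = small_cylinder a i.
Proof.
have [[i [yi yai]]|/forallNP N] := pselect (exists i,
    (forall j, (j < i)%N -> y (a + j)%N = false) /\ y (a + i)%N).
  right; exists i; apply/seteqP; split=> z; last by move=> ?; exists i.
  move=> [k [yk yak] zk]; have [ik|ki|->//] := ltngtP i k.
    by rewrite yk in yai.
  by rewrite yi in yak.
by left; rewrite -subset0 => z [i [? ? _]]; apply: (N i).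
Qed.

Lemma decode_cylinder a y : cylinder (decode a y).
Proof.
by have [->|[i ->]] := decodeP a y; [exact: cylinder0|exact: small_cylinder_cylinder].
Qed.

Lemma outer_decode a y : (outer R (decode a y) <= (2 ^- a)%:E)%E.
Proof.
have [->|[i ->]] := decodeP a y; last exact: outer_small_cylinder.
by rewrite outer0 lee_fin invr_ge0 exprn_ge0.
Qed.

(** The bounds [2 ^- a] for [a > n] sum to [2 ^- n]; hence the strict inequality. *)
Lemma outer_decode_tail n y :
  (outer R [set z | exists2 a, (n < a)%N & decode a y z] <= (2 ^- n)%:E)%E.
Proof.
apply: (@le_trans _ _ (outer R (\bigcup_k decode (n + k.+1)%N y))).
  apply: le_outer => z [a na az]; exists (a - n.+1)%N => //.
  by rewrite addnS -addSn subnKC.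
apply: (le_trans (outer_sigma_subadditive _ _)).
apply: (le_trans _ (epsilon_trick0 xpredT _)); last by rewrite invr_ge0 exprn_ge0.
apply: lee_nneseries => k *; first exact: outer_ge0.
apply: le_trans (outer_decode _ _) _.
by rewrite lee_fin natrX -invfM -exprD.
Qed.

Lemma null_decode_limsup y :
  null R [set z | forall m, exists2 a, (m <= a)%N & decode a y z].
Proof.
apply/nullP/outer_eq0 => n; apply: le_trans (outer_decode_tail n y).
by apply: le_outer => z /(_ n.+1).
Qed.

(** For fixed [m] the conditions on finite windows are clopen, so their intersection is closed; it
    is null because its points are decoded at arbitrarily large positions. *)
Lemma closed_null_decode_liminf g y :
  E [set z | exists m, forall n, (m <= n)%N ->
      exists a, (n <= a < g n)%N /\ decode a y z].
Proof.
pose V n := [set z | exists a, (n <= a < g n)%N /\ decode a y z].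
apply/closed_nullP.
exists (fun m => \bigcap_(n in [set n | (m <= n)%N]) V n).
split=> [m|z [m zm]]; last by exists m.
split.
  apply: closed_bigI => n _; apply: cylinder_closed.
  rewrite (_ : V n = \bigcup_(a < g n) (if (n <= a)%N then decode a y else set0)).
    rewrite bigcup_mkord; elim/big_ind: _ => //; first exact: cylinder0.
      by move=> A B cA cB; exact: cylinderU.
    by move=> a _; case: ifP => _; [exact: decode_cylinder|exact: cylinder0].
  apply/seteqP; split=> z.
    by move=> [a [/andP[na ag] az]]; exists a => //=; rewrite na.
  by move=> [a /= ag]; case: ifP => // na az; exists a; rewrite na ag.
apply/nullP/outer_eq0 => n; apply: le_trans (outer_decode_tail n y).
apply: le_outer => z /(_ (maxn m n.+1)) [/=|a [/andP[na _] az]].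
  exact: leq_maxl.
by exists a => //; exact: leq_trans (leq_maxr _ _) na.
Qed.

Lemma closed_null_coding X : E X -> exists f x, (forall a, (a < f a)%N) /\
  forall z, X z -> exists m, forall k y, (m <= k)%N -> agree x y k (f k) ->
    exists a, (k <= a < f k)%N /\ decode a y z.
Proof.
move=> /closed_nullP[K [KP XK]].
have cnU k : closed (\bigcup_(i < k) K i) /\ null R (\bigcup_(i < k) K i).
  elim: k => [|k [cU nU]].
    rewrite bigcup_mkord big_ord0; split; [exact: closed0|exact/nullP/outer0].
  rewrite bigcup_mkord big_ord_recr -bigcup_mkord; split.
    by apply: closedU => //; exact: (KP k).1.
  apply/nullP/eqP; rewrite eq_le outer_ge0 andbT.
  apply: le_trans (outerU _ _ _) _.
  by rewrite (nullP _ _).1// (nullP _ _).1 ?adde0//; exact: (KP k).2.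
have /choice[c cP] : forall p : nat * nat, exists i,
    \bigcup_(i < p.1.+1) K i `<=` small_cylinder p.2 i.
  move=> [k b] /=; have [cU nU] := cnU k.+1.
  have [|C [cC UC Cb]] := closed_null_cylinder cU nU (_ : 0 < 2 ^- b).
    by rewrite invr_gt0 exprn_gt0.
  by have [i iC] := small_cylinder_surj cC Cb; exists i; rewrite iC.
have [x [f xf]] := block_sequence (fun k b => rcons (nseq (c (k, b)) false) true).
exists f, x; split=> [a|z /XK[j _ Kz]].
  by have [b [ab bf _ _]] := xf a; exact: leq_ltn_trans bf.
exists j => k y jk xy; have [b []] := xf k.
rewrite size_rcons size_nseq => kb bf bcf xb; exists b; rewrite kb bf; split=> //.
have yb i : (i <= c (k, b))%N -> y (b + i)%N = (i == c (k, b)).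
  move=> ic; rewrite -xy ?xb// ?nth_rcons ?size_nseq.
    by move: ic; rewrite leq_eqVlt => /predU1P[->|ic]; rewrite ?ltnn ?eqxx// ic
      nth_nseq ic ltn_eqF.
  rewrite (leq_trans kb) ?leq_addr//= (leq_trans _ bcf)//.
  by rewrite ltn_add2l.
exists (c (k, b)); split=> [i ic||]; first by rewrite yb ?ltn_eqF// ltnW.
  by rewrite yb.
by apply: (cP (k, b)); exists j.
Qed.

End closed_null_sets.

(** * Predictions from a null set *)

Section prediction.
Variable R : realType.
Implicit Types (H Q : set cantor_space).

(** Otherwise [Q] is covered by the [e + 2] small pieces and the set of points equal to 1 on [W], so
    its measure is at most [2 ^- (e + 1) + 2 ^- (e + 2)], below [2 ^- e]. *)
Lemma outer_zero_coordinate Q (e : nat) (W : seq nat) : uniq W -> size W = e.+2 ->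
  ((2 ^- e)%:E <= outer R Q)%E ->
  exists2 w, w \in W & ((2 ^- (2 * e).+2)%:E <= outer R (Q `&` [set z | z w = false]))%E.
Proof.
move=> uW sW Qe; apply: contrapT => /forall2NP N.
pose S w : set cantor_space := Q `&` [set z | z w = false].
have QS : Q `<=` [set z | exists2 w, w \in W & S w z] `|`
    [set z | forall w, w \in W -> z w = true].
  move=> z Qz; have [|Nz] := pselect (exists2 w, w \in W & S w z); first by left.
  right=> w wW; apply: contrapT => /negP zw; apply: Nz; exists w => //.
  by split=> //; exact/negbTE.
have := le_trans Qe (le_trans (le_outer R QS) (outerU _ _ _)).
rewrite leNgt => /negP; apply; rewrite outer_mem// sW.
apply: (@le_lt_trans _ _ ((e.+2%:R * 2 ^- (2 * e).+2)%:E + (2 ^- e.+2)%:E)%E).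
  rewrite leeD2r// -sW; apply: outer_bigcup_seq.
    by rewrite invr_ge0 exprn_ge0.
  move=> w wW; have [//|/negP] := N w; rewrite -ltNge; exact: ltW.
rewrite -EFinD lte_fin.
have e2 : (e.+2%:R : R) <= 2 ^+ e.+1.
  by rewrite -natrX ler_nat; elim: e {QS N Qe sW} => // e IH; rewrite expnS; lia.
have E : (2 * e).+2 = (e.+1 + e.+1)%N by lia.
have p0 : 0 < (2 ^+ e.+1 : R) by rewrite exprn_gt0.
apply: (@le_lt_trans _ _ (2 ^- e.+1 + 2 ^- e.+2)).
  rewrite lerD2r E exprD invfM mulrA -[leRHS]mul1r.
  apply: ler_wpM2r; first by rewrite invr_ge0 ltW.
  by rewrite ler_pdivrMr// mul1r.
have q0 : 0 < (2 ^- e : R) by rewrite invr_gt0 exprn_gt0.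
by rewrite !exprS !invfM; lra.
Qed.

Lemma bounded_enumeration (B : set nat) (k : nat) :
  (forall W, uniq W -> (forall w, w \in W -> B w) -> (size W <= k)%N) ->
  exists l, (size l <= k)%N /\ forall w, B w -> w \in l.
Proof.
move=> Bk; pose P n :=
  `[< exists W, [/\ uniq W, forall w, w \in W -> B w & size W = n] >].
have P0 : exists n, P n by exists 0%N; apply/asboolP; exists [::].
have Pk n : P n -> (n <= k)%N by move=> /asboolP[W [uW WB <-]]; exact: Bk.
case: (ex_maxnP P0 Pk) => n /asboolP[W [uW WB Wn]] nmax.
exists W; split=> [|w Bw]; first exact: Bk.
apply: contrapT => /negP wW; suff /nmax : P n.+1 by rewrite ltnn.
apply/asboolP; exists (w :: W); rewrite /= wW uW Wn; split=> // v.
by rewrite inE => /predU1P[->//|]; exact: WB.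
Qed.

(** After [n] zeros have been imposed, measure [2 ^- exponent n] should remain; the recursion is the
    loss in [outer_zero_coordinate], starting from one half. *)
Fixpoint exponent (n : nat) : nat := if n is k.+1 then (2 * exponent k).+2 else 1.

(* Let P be a closed set of measure at least 1/2 disjoint from H. Requiring zeros
   at w k, w (k + 1), ... one after the other must at some step reduce the measure
   of P excessively: otherwise compactness gives a point of P vanishing at all of
   them, which lies in H. At each step only few coordinates can do that. *)
Lemma null_prediction H : null R H -> exists cand : seq nat -> seq nat,
  (forall s, (size (cand s) <= (exponent (size s)).+1)%N) /\
  forall w, tail_zero w `<=` H -> forall k, exists n,
    w (k + n)%N \in cand (mkseq (fun i => w (k + i)%N) n).
Proof.
move=> /nullP H0.
have [|F [cF HF F2]] := @outer_null_cover R H 2^-1 H0; first by rewrite invr_gt0.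
pose P : set cantor_space := ~` \bigcup_i F i.
have P2 : ((2 ^- 1)%:E <= outer R P)%E.
  have F2' := le_trans (outer_sigma_subadditive R F) F2.
  have : (1 <= outer R P + (2^-1)%:E)%E.
    rewrite -(outer_setT R) -(setvU (\bigcup_i F i)).
    apply: le_trans (outerU _ _ _) _; exact: leeD2l.
  rewrite expr1 -leeBlDr// -EFinB; apply: le_trans; rewrite lee_fin; lra.
pose Q (s : seq nat) : set cantor_space :=
  P `&` [set z | forall i, i \in s -> z i = false].
pose large (s : seq nat) := ((2 ^- exponent (size s))%:E <= outer R (Q s))%E.
have QS s w : Q (rcons s w) = Q s `&` [set z | z w = false].
  apply/seteqP; split=> z.
    move=> [Pz zs]; split; last by apply: zs; rewrite mem_rcons inE eqxx.
    by split=> // i si; apply: zs; rewrite mem_rcons inE si orbT.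
  move=> [[Pz zs] zw]; split=> // i; rewrite mem_rcons inE.
  by move=> /predU1P[->//|]; exact: zs.
(* The candidates after [s] are the coordinates whose vanishing takes the measure below the next
   threshold; [outer_zero_coordinate] limits their number. *)
have /choice[cand candP] : forall s, exists l, (size l <= (exponent (size s)).+1)%N /\
    forall w, (large s /\ ~ large (rcons s w)) -> w \in l.
  move=> s; apply: bounded_enumeration => W uW WB; rewrite leqNgt; apply/negP => sW.
  have uW' : uniq (take (exponent (size s)).+2 W) by exact: take_uniq.
  have sW' : size (take (exponent (size s)).+2 W) = (exponent (size s)).+2.
    by rewrite size_takel.
  have [|w ws] := @outer_zero_coordinate (Q s) _ _ uW' sW'.
    by have [w /WB[]] : exists w, w \in W by case: W sW {uW WB uW' sW'} => // w W _;
      exists w; rewrite mem_head.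
  by rewrite -QS; have [_ +] := WB w (mem_take ws); rewrite /large size_rcons.
exists cand; split=> [s|w wH k]; first exact: (candP s).1.
apply: contrapT => /forallNP N.
pose s n := mkseq (fun i => w (k + i)%N) n.
have sL n : large (s n).
  elim: n => [|n IH].
    rewrite /large /s /= /Q (_ : _ `&` _ = P)//.
    by apply/seteqP; split=> z // -[].
  apply: contrapT => nL; apply: (N n); apply: (candP _).2; split=> //.
  by rewrite -mkseqS.
pose G i : set cantor_space := F i `|` [set z | z (w (k + i)%N) = true].
have [||n Gn] := @closed_countable_subcover setT G closedT.
- move=> i; apply: openU; first exact/cylinder_open/cF.
  by apply: cylinder_open; eexists; exact: coordinate_depends.
- move=> z _; have [[i zi]|/forallNP Nz] := pselect (exists i, z (w (k + i)%N) = true).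
    by exists i => //; right.
  have [|i _ Fz] := HF z; last by exists i => //; left.
  apply: wH; exists k => n kn; rewrite -(subnKC kn).
  exact/negbTE/negP/Nz.
have : large (s n) := sL n; rewrite /large (_ : Q (s n) = set0).
  by rewrite outer0 leNgt lte_fin invr_gt0 exprn_gt0.
rewrite -subset0 => z [Pz zs]; have [i /= ltin [Fz|]] := Gn z I.
  by apply: Pz; exists i.
by rewrite /= zs//; apply/mapP; exists i; rewrite // mem_iota.
Qed.

End prediction.

(** * Guessing a function infinitely often *)

Section infinitely_often_equal.
Local Open Scope nat_scope.

Lemma uniq_unzip1_inj (T U : eqType) (s : seq (T * U)) m t u :
  uniq (unzip1 s) -> (m, t) \in s -> (m, u) \in s -> t = u.
Proof.
elim: s => //= -[a b] s IH /= /andP[as_ us]; rewrite !inE !xpair_eqE.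
have ms v : (m, v) \in s -> m != a.
  by move=> mv; apply: contraNneq as_ => <-; apply/mapP; exists (m, v).
move=> /orP[/andP[/eqP ma /eqP ->]|mt] /orP[/andP[/eqP mb /eqP ->]|mu] //.
- by have := ms _ mu; rewrite ma eqxx.
- by have := ms _ mt; rewrite mb eqxx.
- exact: IH.
Qed.

(** The lists are served in turn, each reserving a fresh argument if it has one. Before stage [p] at
    most [p] arguments are reserved and [b p] lie below the bound, so more than [p + b p] distinct
    arguments leave one to spare. *)
Lemma select_guesses (l : nat -> seq (nat * nat)) (b : nat -> nat) :
  exists y : nat -> nat, forall p, uniq (unzip1 (l p)) -> p + b p < size (l p) ->
    exists m t, [/\ (m, t) \in l p, b p <= m & y m = t].
Proof.
pose fresh p (U : seq (nat * nat)) :=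
  [seq q <- l p | (b p <= q.1) && (q.1 \notin unzip1 U)].
pose U := fix U p : seq (nat * nat) := if p is k.+1 then
  if fresh k (U k) is q :: _ then q :: U k else U k else [::].
have US p : U p.+1 = if fresh p (U p) is q :: _ then q :: U p else U p by [].
have Uuniq p : uniq (unzip1 (U p)).
  elim: p => // p IH; rewrite US; case E: (fresh p (U p)) => [//|q r] /=.
  have : q \in fresh p (U p) by rewrite E mem_head.
  by rewrite mem_filter IH andbT => /andP[/andP[]].
have Usize p : size (U p) <= p.
  elim: p => // p IH; rewrite US; case: (fresh p (U p)) => /= *; last by [].
  exact: leqW.
have Usub p r q : p <= r -> q \in U p -> q \in U r.
  move=> pr qp; rewrite -(subnK pr); elim: (r - p) => // n IH.
  by rewrite addSn US; case: (fresh _ _) => // *; rewrite inE IH orbT.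
have /choice[y yP] : forall m, exists t, forall p u, (m, u) \in U p -> t = u.
  move=> m; have [[t [p mt]]|/forallNP N] := pselect (exists t p, (m, t) \in U p).
    exists t => r u mu; apply: (uniq_unzip1_inj (Uuniq (maxn p r)) (m := m)).
      exact: Usub (leq_maxl _ _) mt.
    exact: Usub (leq_maxr _ _) mu.
  by exists 0 => p u mu; exfalso; apply: (N u); exists p.
exists y => p lu lsz.
case E: (fresh p (U p)) => [|[m t] r].
  have : {subset unzip1 (l p) <= iota 0 (b p) ++ unzip1 (U p)}.
    move=> _ /mapP[q ql ->]; rewrite mem_cat mem_iota add0n /= ltnNge.
    apply: contraT; rewrite negb_or negbK => qf.
    by have : q \in fresh p (U p); [rewrite mem_filter qf|rewrite E].
  move=> /(uniq_leq_size lu); rewrite size_cat size_iota !size_map.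
  by move: lsz (Usize p); lia.
have : (m, t) \in fresh p (U p) by rewrite E mem_head.
rewrite mem_filter /= => /andP[/andP[bm _] ml]; exists m, t; split=> //.
by apply: (yP m p.+1); rewrite US E mem_head.
Qed.

Variables (e x : nat -> nat).

(* The number of values of x recorded after the history u exceeds every index
   under which the guesses made from a final segment of u are processed. *)
Definition horizon (u : seq nat) : nat :=
  (\max_(k < (size u).+1) \max_(i < (exponent (size (drop k u))).+1)
    (pickle (k : nat, drop k u, i : nat) + k)).+1.

(** Recording the length of the history makes [encode] injective; the listed values of [x] turn a
    correct prediction into many correct guesses. *)
Definition record (u : seq nat) : nat :=
  pickle (size u, mkseq (fun j => (e j, x (e j))) (horizon u)).

Fixpoint history (n : nat) : seq nat :=
  if n is k.+1 then rcons (history k) (record (history k)) else [::].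

Definition encode (n : nat) : nat := record (history n).

Lemma historyE n : history n = mkseq encode n.
Proof. by elim: n => //= n IH; rewrite mkseqS -IH. Qed.

Lemma encode_inj : injective encode.
Proof.
move=> m n /(pcan_inj pickleK)[].
by rewrite !historyE !size_mkseq.
Qed.

End infinitely_often_equal.

(** Each triple of a start [k], a history [s] and a candidate index [i] is a stage of
    [select_guesses] with bound [k]. For the right prediction, [horizon] makes the list of guesses
    long enough for that stage. *)
Lemma infinitely_often_equal (R : realType) (H : set cantor_space) : null R H ->
  exists y : nat -> nat, forall e x, injective e ->
    tail_zero (encode e x) `<=` H ->
    forall k, exists j, (k <= e j)%N /\ y (e j) = x (e j).
Proof.
move=> /null_prediction[cand [cand_size candP]].
pose arg p : nat * seq nat * nat := odflt (0%N, [::], 0%N) (unpickle p).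
pose l p : seq (nat * nat) :=
  (odflt (0%N, [::]) (unpickle (nth 0%N (cand (arg p).1.2) (arg p).2))).2.
have [y yP] := select_guesses l (fun p => (arg p).1.1).
exists y => e x einj /candP wP k; have [n wn] := wP k.
set s := mkseq _ n in wn; set i := index (encode e x (k + n)) (cand s).
have icand : (i < size (cand s))%N by rewrite index_mem.
pose p := pickle (k, s, i).
have argE : arg p = (k, s, i) by rewrite /arg pickleK.
have lE : l p = mkseq (fun j => (e j, x (e j))) (horizon (history e x (k + n))).
  by rewrite /l argE /= nth_index// /encode /record pickleK.
have sE : s = drop k (history e x (k + n)).
  rewrite historyE /s /mkseq -map_drop drop_iota add0n addKn.
  by rewrite -[in RHS](addn0 k) iotaDl -map_comp.
have [||m [t [mt km ymt]]] := yP p.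
- by rewrite lE /unzip1 -map_comp map_inj_uniq ?iota_uniq.
- rewrite lE size_mkseq argE /= ltnS.
  have kn : (k < (size (history e x (k + n))).+1)%N.
    by rewrite historyE size_mkseq ltnS leq_addr.
  apply: leq_trans (leq_bigmax (Ordinal kn)); rewrite /= -sE.
  have ib : (i < (exponent (size s)).+1)%N.
    exact: leq_trans icand (cand_size s).
  exact: (leq_bigmax (F := fun j : 'I_ _ => (pickle (k, s, j : nat) + k)%N)
    (Ordinal ib)).
rewrite lE in mt; have /mapP[j _ [mE tE]] := mt.
by exists j; rewrite -tE -mE ymt; split=> //; move: km; rewrite argE.
Qed.

(** * From meager sets to closed null sets *)

Lemma infinite_enumeration (X : set nat) :
  (forall k, exists m, (k <= m)%N /\ X m) ->
  exists e : nat -> nat, injective e /\ forall j, X (e j).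
Proof.
move=> /choice[h hP].
pose e := fix e j := if j is k.+1 then h (e k).+1 else h 0%N.
have eS j : (e j < e j.+1)%N := (hP _).1.
have einc : {homo e : i j / (i < j)%N}.
  by apply: homo_ltn => // i j k; exact: ltn_trans.
exists e; split=> [i j eij|[|j]]; [|exact: (hP _).2|exact: (hP _).2].
by have [/einc|/einc|//] := ltngtP i j; rewrite eij ltnn.
Qed.

(** * Interval partitions and guesses on their pieces *)

Section partition.
Local Open Scope nat_scope.
Variable y : nat -> nat.

Fixpoint cut (m : nat) : nat :=
  if m is k.+1 then (\max_(a < (cut k).+1) maxn (y a) a).+1 else 0.

Lemma cut_ge m a : a <= cut m -> y a < cut m.+1 /\ a < cut m.+1.
Proof.
rewrite -ltnS => am; have := leq_bigmax (F := fun a : 'I_(cut m).+1 =>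
  maxn (y a) a) (Ordinal am).
by rewrite geq_max /= => /andP[ya aa]; rewrite !ltnS.
Qed.

Lemma cut_lt m : cut m < cut m.+1.
Proof. exact: (cut_ge (leqnn _)).2. Qed.

Lemma cut_mono : {mono cut : m n / m <= n}.
Proof.
by apply: leq_mono; apply: homo_ltn => [i j k|]; [exact: ltn_trans|exact: cut_lt].
Qed.

Lemma cut_interval i : exists m, cut m <= i < cut m.+1.
Proof.
elim: i => [|i [m /andP[mi im]]]; first by exists 0; rewrite /= ltnS.
have [lt|ge] := ltnP i.+1 (cut m.+1); first by exists m; rewrite lt ltnW.
by exists m.+1; rewrite ge (leq_ltn_trans im)// cut_lt.
Qed.

Lemma cut_interval_uniq i m n : cut m <= i < cut m.+1 -> cut n <= i < cut n.+1 ->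
  m = n.
Proof.
have le k l : cut k <= i < cut k.+1 -> cut l <= i < cut l.+1 -> k <= l.
  move=> /andP[ki _] /andP[_ il].
  by rewrite -ltnS -(leqW_mono cut_mono) (leq_ltn_trans ki).
by move=> mi ni; apply/eqP; rewrite eqn_leq (le m n)//= (le n m).
Qed.

(* If [a, f a) straddles a cut point, then [f a, f (f a)) does not. *)
Lemma cut_captures f : (forall k, exists a, k <= a /\ y a = f (f a)) ->
  (forall a, a < f a) ->
  forall k, exists m, k <= m /\ exists a, cut m <= a /\ f a <= cut m.+1.
Proof.
move=> yf fa k; have [a [ka ya]] := yf (cut k).
have [m /andP[ma am]] := cut_interval a.
have km : k <= m by rewrite -ltnS -(leqW_mono cut_mono) (leq_ltn_trans ka).
have [fm|mf] := leqP (f a) (cut m.+1); first by exists m; split=> //; exists a.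
exists m.+1; split; first exact: leqW.
exists (f a); split; first exact: ltnW.
by rewrite -ya ltnW//; case: (@cut_ge m.+1 a (ltnW am)).
Qed.

Definition piece (x : nat -> bool) (m : nat) : nat :=
  pickle (mkseq (fun i => x (cut m + i)) (cut m.+1 - cut m)).

Lemma piece_guess (v : nat -> nat) : exists z : nat -> bool, forall x m,
  v m = piece x m -> agree z x (cut m) (cut m.+1).
Proof.
have /choice[b bP] := cut_interval.
exists (fun i => nth false (odflt [::] (unpickle (v (b i)))) (i - cut (b i))).
move=> x m vm i mi; have -> : b i = m := cut_interval_uniq (bP i) mi.
rewrite vm pickleK /= nth_mkseq; case/andP: mi => mi im; first by rewrite subnKC.
by rewrite ltn_sub2r// cut_lt.
Qed.

End partition.

Section two_stages.
Variable R : realType.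
Notation E := (closed_null_ideal R).

(* The null set H1 yields a partition with infinitely many pieces containing an
   interval [a, f a); the null set H2 then yields a point agreeing with x on
   infinitely many of these pieces. *)
Lemma two_stage_escape : exists (phi1 : (nat -> nat) -> set cantor_space)
    (phi2 : set cantor_space -> (nat -> nat) -> cantor_space -> set cantor_space)
    (psi : set cantor_space -> set cantor_space -> cantor_space),
  forall f x, (forall a, (a < f a)%N) -> E (phi1 f) /\
    forall H1, null R H1 -> phi1 f `<=` H1 -> E (phi2 H1 f x) /\
      forall H2, null R H2 -> phi2 H1 f x `<=` H2 -> ~ avoid f x (psi H1 H2).
Proof.
(* [Y] depends on the null set alone, which keeps [psi H1 H2] independent of [f] and [x]. *)
have /choice[Y YP] : forall H, exists y : nat -> nat, null R H ->
    forall e x, injective e -> tail_zero (encode e x) `<=` H ->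
    forall k, exists j, (k <= e j)%N /\ y (e j) = x (e j).
  move=> H; have [nH|nH] := pselect (null R H).
    by have [y yP] := infinitely_often_equal nH; exists y.
  by exists id => /nH.
pose X H (f : nat -> nat) := [set m | exists a,
  (cut (Y H) m <= a)%N /\ (f a <= cut (Y H) m.+1)%N].
have /choice[e eP] : forall p : set cantor_space * (nat -> nat), exists e : nat -> nat,
    (forall k, exists m, (k <= m)%N /\ X p.1 p.2 m) ->
    injective e /\ forall j, X p.1 p.2 (e j).
  move=> p; have [Xinf|Xfin] := pselect (forall k, exists m, (k <= m)%N /\ X p.1 p.2 m).
    by have [e eP] := infinite_enumeration Xinf; exists e.
  by exists id => /Xfin.
have /choice[psi psiP] : forall p : set cantor_space * set cantor_space,
    exists z : cantor_space, forall x m, Y p.2 m = piece (Y p.1) x m ->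
    agree z x (cut (Y p.1) m) (cut (Y p.1) m.+1).
  by move=> p; exact: piece_guess.
(* The first function to be guessed is [f] iterated twice, as required by [cut_captures]; the second
   consists of the pieces of [x], at indices of pieces that contain some [[a, f a)]. *)
exists (fun f => tail_zero (encode id (fun a => f (f a)))).
exists (fun H1 f x => tail_zero (encode (e (H1, f)) (piece (Y H1) x))).
exists (fun H1 H2 => psi (H1, H2)).
move=> f x fa; split.
  by apply: closed_null_tail_zero; exact: encode_inj.
move=> H1 nH1 fH1; split.
  by apply: closed_null_tail_zero; exact: encode_inj.
have [einj eX] : injective (e (H1, f)) /\ forall j, X H1 f (e (H1, f) j).
  apply: (eP (H1, f)); apply: cut_captures => // k.
  by have [a aP] := YP _ nH1 _ _ (@inj_id nat) fH1 k; exists a.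
move=> H2 nH2 xH2 [m mz].
have [j [mj Yj]] := YP _ nH2 _ _ einj xH2 m.
have [a [ja aj]] := eX j; apply: (mz a).
  apply: leq_trans ja; apply: leq_trans mj _.
  by elim: (e _ _) => // n /leq_ltn_trans; apply; exact: cut_lt.
by apply: agree_sub ja aj _; exact: (psiP (H1, H2)).
Qed.

(* A set of zeros whose gaps contain intervals on which y agrees with x bounds
   how far one has to look for such an interval. *)
Lemma avoid_escape_bound f x y : (forall a, (a < f a)%N) -> ~ avoid f x y ->
  exists w, injective w /\ forall g z, tail_zero w `<=` avoid g z ->
    avoid f x `<=` avoid (fun n => \max_(i < (g n).+1) g i)%N y.
Proof.
move=> fa /avoidPn xy.
have /choice[h hP] : forall m, exists a, (m <= a)%N /\ agree y x a (f a).
  by move=> m; have [a] := xy m; exists a.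
pose w := fix w j := if j is k.+1 then f (h (w k)) else 0%N.
have wS j : (w j < w j.+1)%N by apply: leq_ltn_trans (fa _); exact: (hP _).1.
have winc : {mono w : i j / (i <= j)%N}.
  by apply: leq_mono; apply: homo_ltn => // i j k; exact: ltn_trans.
exists w; split=> [i j wij|g z /tail_zero_sub_avoid[m mw] c [m' mc]].
  by apply/eqP; rewrite eqn_leq -[(i <= j)%N]winc -[(j <= i)%N]winc wij leqnn.
exists (maxn m m') => n; rewrite geq_max => /andP[mn m'n] cy.
have [j /andP[nj jn]] := mw n mn.
(* The interval starting at [h (w j)] ends at [w j.+1], hence by [w i], which lies below
   [g (w j).+1], a term of the maximum since [w j < g n]. *)
have [|i /andP[ji ig]] := mw (w j).+1; first exact: leq_trans mn (leqW nj).
have nh : (n <= h (w j))%N := leq_trans nj (hP _).1.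
apply: (mc (h (w j)) (leq_trans m'n nh)) => k /andP[hk kf].
rewrite -(hP (w j)).2 ?hk//; apply: cy; rewrite (leq_trans nh hk)/=.
apply: leq_trans kf _; rewrite -[f _]/(w j.+1).
apply: (@leq_trans (w i)); first by rewrite winc -(leqW_mono winc).
apply: leq_trans (ltnW ig) _.
have jg : ((w j).+1 < (g n).+1)%N by rewrite ltnS.
exact: (leq_bigmax (F := fun i : 'I_(g n).+1 => g i) (Ordinal jg)).
Qed.

(** The second clause serves [add_closed_null_null] and [cof_closed_null_null], the third
    [add_closed_null] and [cof_closed_null]. *)
Lemma closed_null_to_meager : exists phi : set cantor_space -> set cantor_space,
  forall X, E X -> [/\ meager (phi X),
    forall c, ~ phi X c ->
      X `<=` [set z | forall m, exists2 a, (m <= a)%N & decode R a c z] &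
    forall g y, phi X `<=` avoid g y ->
      X `<=` [set z | exists m, forall n, (m <= n)%N ->
        exists a, (n <= a < g n)%N /\ decode R a y z]].
Proof.
have /choice[phi phiP] : forall X, exists P : set cantor_space,
    E X -> exists f x, [/\ (forall a, (a < f a)%N), P = avoid f x &
    forall z, X z -> exists m, forall k y, (m <= k)%N -> agree x y k (f k) ->
      exists a, (k <= a < f k)%N /\ decode R a y z].
  move=> X; have [EX|nEX] := pselect (E X); last by exists set0 => /nEX.
  have [f [x [fa xP]]] := closed_null_coding EX.
  by exists (avoid f x) => _; exists f, x.
exists phi => X /phiP[f [x [fa -> xP]]]; split; first exact: avoid_meager.
- move=> c /avoidPn cx z /xP[m mz] k; have [a ka ca] := cx (maxn m k).
  have [||b [/andP[ab _] bz]] := mz a c.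
  + exact: leq_trans (leq_maxl _ _) ka.
  + by move=> i ia; rewrite ca.
  by exists b => //; apply: leq_trans ab; exact: leq_trans (leq_maxr _ _) ka.
- move=> g y /(avoid_subset fa)[m mxy] z /xP[m' mz].
  exists (maxn m m') => n; rewrite geq_max => /andP[mn m'n].
  have [a [na an xya]] := mxy n mn.
  have [|b [/andP[ab ba] bz]] := mz a y _ xya; first exact: leq_trans na.
  by exists b; rewrite (leq_trans na ab) (leq_trans ba an).
Qed.

Definition singletons : set (set cantor_space) := range set1.

Lemma bigcup_singletons : \bigcup_(X in singletons) X = setT.
Proof. by apply/seteqP; split=> // x _; exists [set x] => //; exists x. Qed.

Lemma singletons_closed_null : singletons `<=` E.
Proof. by move=> _ [x _ <-]; exact: closed_null_set1. Qed.

(** Singletons lie in E, so a countable cofinal family would cover the space by null sets. Infinity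
    is what bounds the number of pairs and triples of members. *)
Lemma cof_infinite (A : set (set cantor_space)) : A `<=` null R ->
  (forall B, E B -> exists2 X, A X & B `<=` X) -> infinite_set A.
Proof.
move=> An Acof /finite_set_countable/countable_injP[k kinj].
apply: (@null_setT R); pose F n := \bigcup_(X in [set X | A X /\ k X = n]) X.
apply: (@null_subset _ _ (\bigcup_n F n)) => [x _|].
  have [X AX xX] := Acof _ (@closed_null_set1 R x).
  by exists (k X) => //; exists X => //; exact: xX.
apply: null_bigcup => n.
have [[X [AX kX]]|/forallNP N] := pselect (exists X, A X /\ k X = n).
  apply: null_subset (An _ AX) => z [X' [AX' kX'] zX'].
  by have -> : X = X' by apply: kinj; rewrite ?inE// kX kX'.
by apply: null_subset (closed_null_sub_null (@closed_null_set1 R point)) => z [X /N].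
Qed.

(** The stages for meager sets, with every choice made beforehand. [psi] and [chi] take no argument
    [M], so the same sets [H1], [H2], [H3] give one point and one meager set for a whole family. *)
Lemma meager_stages : exists (phi1 : set cantor_space -> set cantor_space)
    (phi2 : set cantor_space -> set cantor_space -> set cantor_space)
    (phi3 : set cantor_space -> set cantor_space -> set cantor_space ->
      set cantor_space)
    (psi : set cantor_space -> set cantor_space -> cantor_space)
    (chi : set cantor_space -> set cantor_space -> set cantor_space ->
      set cantor_space),
  forall M, meager M -> E (phi1 M) /\
    forall H1, null R H1 -> phi1 M `<=` H1 -> E (phi2 H1 M) /\
      forall H2, null R H2 -> phi2 H1 M `<=` H2 ->
        [/\ ~ M (psi H1 H2), E (phi3 H1 H2 M) &
        forall H3, E H3 -> phi3 H1 H2 M `<=` H3 ->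
          meager (chi H1 H2 H3) /\ M `<=` chi H1 H2 H3].
Proof.
have [phi1 [phi2 [psi P]]] := two_stage_escape.
have /choice[q qP] : forall M, exists q : (nat -> nat) * cantor_space,
    meager M -> (forall a, (a < q.1 a)%N) /\ M `<=` avoid q.1 q.2.
  move=> M; have [mM|mM] := pselect (meager M); last by exists (id, point) => /mM.
  by have [f [x fx]] := meager_sub_avoid mM; exists (f, x).
have /choice[w wP] : forall p : set cantor_space * cantor_space, exists w : nat -> nat,
    meager p.1 -> ~ avoid (q p.1).1 (q p.1).2 p.2 ->
    injective w /\ forall g z, tail_zero w `<=` avoid g z ->
    avoid (q p.1).1 (q p.1).2 `<=` avoid (fun n => \max_(i < (g n).+1) g i)%N p.2.
  move=> [M y] /=; have [[mM yM]|N] := pselect (meager M /\ ~ avoid (q M).1 (q M).2 y).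
    have [fa _] := qP _ mM.
    by have [w wP] := avoid_escape_bound fa yM; exists w.
  by exists id => mM yM; exfalso; apply: N.
have /choice[g gP] : forall H, exists g : nat -> nat, E H ->
    exists z, H `<=` avoid g z.
  move=> H; have [EH|nE] := pselect (E H); last by exists id => /nE.
  have [g [z [_ Hg]]] := meager_sub_avoid (closed_null_sub_meager EH).
  by exists g => _; exists z.
exists (fun M => phi1 (q M).1), (fun H M => phi2 H (q M).1 (q M).2).
exists (fun H1 H2 M => tail_zero (w (M, psi H1 H2))), psi.
exists (fun H1 H2 H3 => avoid (fun n => \max_(i < (g H3 n).+1) g H3 i)%N (psi H1 H2)).
move=> M mM; have [fa Mq] := qP _ mM.
have [E1 P1] := P _ (q M).2 fa; split=> // H1 nH1 H1P.
have [E2 P2] := P1 _ nH1 H1P; split=> // H2 nH2 H2P.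
have [winj wg] := wP (M, psi H1 H2) mM (P2 _ nH2 H2P).
split=> [/Mq||H3 EH3 H3P]; [exact: P2|exact: closed_null_tail_zero|].
split; first exact: avoid_meager.
have [z H3z] := gP _ EH3; apply: subset_trans Mq _.
exact: wg (subset_trans H3P H3z).
Qed.

(** * The four equalities of cardinal invariants *)

Lemma add_closed_null_null :
  same_card (add_ideals E (null R)) (cov_ideal meager).
Proof.
apply: same_card_min.
- exists singletons; split; first exact: singletons_closed_null.
  by rewrite bigcup_singletons; exact: null_setT.
- have [phi phiP] := closed_null_to_meager.
  move=> A [AE AN]; exists (phi @` A); last exact: card_image_le.
  split=> [_ [X /AE/phiP[mX _ _] <-] //|].
  apply/seteqP; split=> // c _; apply: contrapT => Nc; apply: AN.
  apply: null_subset (@null_decode_limsup R c) => z [X AX Xz].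
  have [_ + _] := phiP _ (AE _ AX); apply; last exact: Xz.
  by move=> cX; apply: Nc; exists (phi X) => //; exists X.
- have [phi1 [phi2 [phi3 [psi [chi P]]]]] := meager_stages.
  move=> A [AM AT].
  (* Either the first stage already gives a family with non-null union, or this union serves as one
     [H1] for all members of [A]. *)
  have [N1|/contrapT] := pselect (~ null R (\bigcup_(X in phi1 @` A) X)).
    exists (phi1 @` A); last exact: card_image_le.
    by split=> // _ [M /AM/P[EM _] <-].
  set H1 := \bigcup_(X in _) X => nH1.
  have sub1 M : A M -> phi1 M `<=` H1.
    by move=> AM' z zM; exists (phi1 M) => //; exists M.
  exists (phi2 H1 @` A); last exact: card_image_le.
  split=> [_ [M MA <-]|].
    by have [_ /(_ _ nH1 (sub1 _ MA))[]] := P _ (AM _ MA).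
  set H2 := \bigcup_(X in _) X => nH2.
  (* The point [psi H1 H2] lies outside all members of [A], against [A] covering the space. *)
  have : (\bigcup_(X in A) X) (psi H1 H2) by rewrite AT.
  move=> [M MA]; have [_ /(_ _ nH1 (sub1 _ MA))[_ PM]] := P _ (AM _ MA).
  have [|//] := PM _ nH2.
  by move=> z zM; exists (phi2 H1 M) => //; exists M.
Qed.

Lemma add_closed_null : same_card (add_ideal E) (add_ideal meager).
Proof.
apply: same_card_min.
- exists singletons; split; first exact: singletons_closed_null.
  by rewrite bigcup_singletons => /closed_null_sub_null/null_setT.
- have [phi phiP] := closed_null_to_meager.
  move=> A [AE AN]; exists (phi @` A); last exact: card_image_le.
  split=> [_ [X /AE/phiP[mX _ _] <-] //|].
  move=> /meager_sub_avoid[g [y [_ gy]]]; apply: AN.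
  have [_ ES _] := closed_null_sigma_ideal R.
  apply: (ES _ _ _ (@closed_null_decode_liminf R g y)) => z [X AX Xz].
  have [_ _ +] := phiP _ (AE _ AX); apply; last exact: Xz.
  apply: subset_trans gy => c cX; exists (phi X) => //; by exists X.
- have [phi1 [phi2 [phi3 [psi [chi P]]]]] := meager_stages.
  move=> A [AM AN].
  have [N1|/contrapT] := pselect (~ E (\bigcup_(X in phi1 @` A) X)).
    exists (phi1 @` A); last exact: card_image_le.
    by split=> // _ [M /AM/P[EM _] <-].
  set H1 := \bigcup_(X in _) X => E1; have nH1 := closed_null_sub_null E1.
  have sub1 M : A M -> phi1 M `<=` H1.
    by move=> AM' z zM; exists (phi1 M) => //; exists M.
  have P1 M (MA : A M) := (P _ (AM _ MA)).2 _ nH1 (sub1 _ MA).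
  have [N2|/contrapT] := pselect (~ E (\bigcup_(X in phi2 H1 @` A) X)).
    exists (phi2 H1 @` A); last exact: card_image_le.
    by split=> // _ [M /P1[EM _] <-].
  set H2 := \bigcup_(X in _) X => E2; have nH2 := closed_null_sub_null E2.
  have sub2 M : A M -> phi2 H1 M `<=` H2.
    by move=> AM' z zM; exists (phi2 H1 M) => //; exists M.
  have P2 M (MA : A M) := (P1 _ MA).2 _ nH2 (sub2 _ MA).
  exists (phi3 H1 H2 @` A); last exact: card_image_le.
  split=> [_ [M /P2[_ EM _] <-] //|].
  set H3 := \bigcup_(X in _) X => E3; apply: AN.
  have sub3 M : A M -> phi3 H1 H2 M `<=` H3.
    by move=> AM' z zM; exists (phi3 H1 H2 M) => //; exists M.
  have P3 M (MA : A M) : meager (chi H1 H2 H3) /\ M `<=` chi H1 H2 H3.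
    by have [_ _] := P2 _ MA; apply=> //; exact: sub3.
  (* The set [chi H1 H2 H3] contains all members of [A], but its meagerness is obtained from one of
     them; the empty family is treated apart. *)
  have [->|/set0P[M0 A0]] := eqVneq A set0.
    rewrite bigcup_set0; exists (fun=> set0); split=> // _.
    by rewrite /nowhere_dense closure0 interior0.
  have [[F [F0 FP]] _] := P3 _ A0.
  by exists F; split=> // z [M /P3[_ MP] /MP]; exact: FP.
Qed.

Lemma cof_closed_null_null :
  same_card (cof_ideals E (null R)) (unif_ideal meager).
Proof.
apply: same_card_min.
- by exists (null R); split=> // B /closed_null_sub_null nB; exists B.
- have [phi1 [phi2 [phi3 [psi [chi P]]]]] := meager_stages.
  move=> A [An Acof].
  (* One member of [A] is used for each stage; as [A] is infinite, its pairs are no more numerous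
     than its members. *)
  exists [set psi H1 H2 | H1 in A & H2 in A]; last first.
    exact/card_le_image_setX/cof_infinite.
  move=> mM; have [E1 P1] := P _ mM.
  have [H1 AH1 H1P] := Acof _ E1; have [E2 P2] := P1 _ (An _ AH1) H1P.
  have [H2 AH2 H2P] := Acof _ E2; have [+ _ _] := P2 _ (An _ AH2) H2P.
  apply.
  by exists H1 => //; exists H2.
- have [phi phiP] := closed_null_to_meager.
  move=> C mC.
  pose H c : set cantor_space :=
    [set z | forall m, exists2 a, (m <= a)%N & decode R a c z].
  exists (H @` C); last exact: card_image_le.
  split=> [_ [c _ <-]|X EX]; first exact: null_decode_limsup.
  have [mX XP _] := phiP _ EX.
  have [c [Cc cX]] : exists c, C c /\ ~ phi X c.
    apply: contrapT => /forallNP N; apply: mC.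
    have [F [F0 XF]] := mX; exists F; split=> // c Cc; apply: XF.
    by apply: contrapT => cX; apply: (N c).
  by exists (H c); [exists c|exact: XP].
Qed.

Lemma cof_closed_null : same_card (cof_ideal E) (cof_ideal meager).
Proof.
apply: same_card_min.
- by exists E; split=> // B EB; exists B.
- have [phi1 [phi2 [phi3 [psi [chi P]]]]] := meager_stages.
  move=> A [AE Acof].
  have An : A `<=` null R by move=> X /AE/closed_null_sub_null.
  have Ainf := cof_infinite An Acof.
  (* [chi] is known to give a meager set for suitable triples; wherever it does not, the empty set
     is used. *)
  pose B p := if `[< meager (chi p.1.1 p.1.2 p.2) >] then chi p.1.1 p.1.2 p.2 else set0.
  have meager0 : meager set0 by exists (fun=> set0); split=> // _;
    rewrite /nowhere_dense closure0 interior0.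
  exists (B @` (A `*` A `*` A)); last first.
    by apply: card_le_trans (card_setX3_infinite Ainf); exact: card_image_le.
  split=> [_ [p _ <-]|M mM]; first by rewrite /B; case: asboolP.
  have [E1 P1] := P _ mM; have [H1 AH1 H1P] := Acof _ E1.
  have [E2 P2] := P1 _ (An _ AH1) H1P; have [H2 AH2 H2P] := Acof _ E2.
  have [_ E3 P3] := P2 _ (An _ AH2) H2P; have [H3 AH3 H3P] := Acof _ E3.
  have [mchi Mchi] := P3 _ (AE _ AH3) H3P.
  exists (chi H1 H2 H3) => //; exists (H1, H2, H3); first by split.
  by rewrite /B /= asboolT.
- have [phi phiP] := closed_null_to_meager.
  move=> C [CM Ccof].
  (* A single decoded set works for all [Y] at once, because it is built from [g] and [y] alone;
     [[set point]] is a default value for non-meager [M]. *)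
  have /choice[psi psiP] : forall M, exists X, E X /\ (meager M ->
      forall Y, E Y -> phi Y `<=` M -> Y `<=` X).
    move=> M; have [/meager_sub_avoid[g [y [_ My]]]|nM] := pselect (meager M).
      eexists; split=> [|_ Y EY YM]; first exact: (@closed_null_decode_liminf R g y).
      by have [_ _ YP] := phiP _ EY; apply: YP; exact: subset_trans My.
    by exists [set point]; split=> [|/nM//]; exact: closed_null_set1.
  exists (psi @` C); last exact: card_image_le.
  split=> [_ [M _ <-]|Y EY]; first exact: (psiP M).1.
  have [mY _ _] := phiP _ EY; have [M CM' YM] := Ccof _ mY.
  exists (psi M); first by exists M.
  exact: (psiP M).2 (CM _ CM') _ EY YM.
Qed.

End two_stages.

Theorem theorem3p1 (R : realType) :
  (same_card (add_ideals (closed_null_ideal R) (null R)) (cov_ideal meager) /\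
   same_card (add_ideal (closed_null_ideal R)) (add_ideal meager)) /\
  (same_card (cof_ideals (closed_null_ideal R) (null R)) (unif_ideal meager) /\
   same_card (cof_ideal (closed_null_ideal R)) (cof_ideal meager)).
Proof.
split; split.
- exact: add_closed_null_null.
- exact: add_closed_null.
- exact: cof_closed_null_null.
- exact: cof_closed_null.
Qed.
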